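(* Fix $r\ge1$. The family $(A_c^q)_c$, indexed by $c=(c_1,\dots,c_r)\in\mathbb{N}^r$ with $c_1+\dots+c_r=r$, satisfies: (a) $A^q_{(1,1,\dots,1)}=[r]_q!$; (b) for every $i\in\{1,\dots,r\}$ with $c_i\ge2$, $$(q+1)A^q_{(c_1,\dots,c_r)}=qA^q_{(c_1,\dots,c_{i-1}+1,c_i-1,\dots,c_r)}+A^q_{(c_1,\dots,c_i-1,c_{i+1}+1,\dots,c_r)},$$ where for $i=1$ the first term on the right is omitted and for $i=r$ the second term on the right is omitted. Moreover, it is the unique family of elements of $\mathbf{k}$ indexed by these $c$ satisfying (a) and (b).
   Context: Let $\mathbf{k}$ be a field of characteristic zero and $q\in\mathbf{k}$ not a nontrivial root of unity; $[m]_q!=\prod_{i=1}^m(1+q+\dots+q^{i-1})$. For $1\le j\le n-1$, $s_j$ swaps $x_j,x_{j+1}$, $\partial_j g=(g-s_jg)/(x_j-x_{j+1})$, $T_j(g)=(q-1)\partial_j(x_jg)+s_jg$; $T_w=T_{j_1}\cdots T_{j_\ell}$ for a reduced word of $w\in S_n$. The $q$-divided symmetrization is $\langle f\rangle_n^q=\sum_{w\in S_n}T_w\big(f/\prod_{j=1}^{n-1}(qx_j-x_{j+1})\big)$. For $c=(c_1,\dots,c_r)\in\mathbb{N}^r$ let $y_c=\prod_{i=1}^r(x_1+\dots+x_i)^{c_i}$, and for $c_1+\dots+c_r=r$ define the remixed Eulerian number $A_c^q=\langle y_c\rangle_{r+1}^q$ (qDS in $x_1,\dots,x_{r+1}$).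 *)

(* Defs.v *)
From HB Require Import structures.
From mathcomp Require Import all_boot all_order all_algebra all_fingroup.
From mathcomp Require Import fraction.
From mathcomp Require Import mpoly.
From Stdlib Require Import ClassicalEpsilon.
Set Implicit Arguments. Unset Strict Implicit. Unset Printing Implicit Defensive.
Import GRing.Theory.
Local Open Scope ring_scope.

Notation "x %:F" := (@FracField.tofrac _ x) : ring_scope.

Section QDS.
Variables (k : fieldType) (q : k) (n : nat).
Local Notation R := {mpoly k[n]}.
Local Notation F := {fraction R}.

Definition cF (a : k) : F := (a%:MP : R)%:F.

(* the variable x_(i+1) (0-based index i), as a rational function; 0 if i >= n *)
Definition xF (i : nat) : F := (\sum_(j < n | val j == i) ('X_j : R))%:F.

(* action of a permutation of the variables on rational functions,
   computed on a representative numerator/denominator pair *)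
Definition fperm (s : 'S_n) (x : F) : F :=
  (msym s (\n_(generic_quotient.repr x)))%:F / (msym s (\d_(generic_quotient.repr x)))%:F.

(* s_(j+1) (0-based j): swaps the variables j and j+1 *)
Definition adj (j : nat) : 'S_n :=
  match insub j, insub j.+1 with
  | Some a, Some b => tperm a b
  | _, _ => 1%g
  end.

Definition sop (j : nat) (g : F) : F := fperm (adj j) g.
Definition ddiff (j : nat) (g : F) : F := (g - sop j g) / (xF j - xF j.+1).
Definition Top (j : nat) (g : F) : F := (cF q - 1) * ddiff j (xF j * g) + sop j g.

Definition word_ok (s : seq nat) : bool := all (fun j => (j.+1 < n)%N) s.
Definition word_perm (s : seq nat) : 'S_n := (\prod_(j <- s) adj j)%g.
Definition reduced_word (w : 'S_n) (s : seq nat) : Prop :=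
  [/\ word_ok s, word_perm s = w &
      forall s', word_ok s' -> word_perm s' = w -> size s <= size s']%N.
Definition rword (w : 'S_n) : seq nat :=
  epsilon (inhabits [::]) (reduced_word w).

Definition Tw (w : 'S_n) (g : F) : F := foldr Top g (rword w).

Definition qDS (f : R) : F :=
  \sum_(w : 'S_n) Tw w (f%:F / \prod_(j < n.-1) (cF q * xF j - xF j.+1)).

Definition ypoly (c : seq nat) : R :=
  \prod_(i < size c) (\sum_(j < n | (val j <= i)%N) ('X_j : R)) ^+ (nth 0%N c i).

End QDS.

Definition qint (k : fieldType) (q : k) (m : nat) : k := \sum_(i < m) q ^+ i.
Definition qfact (k : fieldType) (q : k) (m : nat) : k := \prod_(i < m) qint q i.+1.

Definition wcomp (r : nat) (c : seq nat) : bool := (size c == r) && (sumn c == r).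

Definition shiftL (c : seq nat) (i : nat) : seq nat :=
  set_nth 0%N (set_nth 0%N c i.-1 (nth 0%N c i.-1).+1) i (nth 0%N c i).-1.
Definition shiftR (c : seq nat) (i : nat) : seq nat :=
  set_nth 0%N (set_nth 0%N c i (nth 0%N c i).-1) i.+1 (nth 0%N c i.+1).+1.

Definition remixed_rec (k : fieldType) (q : k) (r : nat) (A : seq nat -> k) : Prop :=
  forall (c : seq nat) (i : nat), wcomp r c -> (i < r)%N -> (2 <= nth 0%N c i)%N ->
    (q + 1) * A c =
      (if (0 < i)%N then q * A (shiftL c i) else 0) +
      (if (i.+1 < r)%N then A (shiftR c i) else 0).

(* Main.v *)
(* The Demazure-Lusztig operators [T_j] satisfy the braid relations, so [T_w] does not depend on the
   reduced word and [S = sum_w T_w] has symmetric image. The operator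
   [X g = sum_w w (g * prod_(a < b) (x_b - q x_a) / (x_b - x_a))] satisfies [X T_j = q X] and
   [X 1 = [n]_q!]; computing [X S] in two ways gives [S = X]. Hence [<f>] is, up to sign, the
   alternant of [f * prod_(a + 1 < b) (x_b - q x_a)] divided by the Vandermonde determinant.

   An alternant vanishes as soon as, in some block of [m] variables, the polynomial has degree less
   than ['C(m, 2)], up to a factor symmetric in that block. The factor [x_(i+1) - q x_i] completes
   the product over the pairs that separate the first [i] variables from the others; since
   [y_c / y_i] still contains [y_i], one of the two blocks has too small a degree and
   [<(y_c / y_i) (x_(i+1) - q x_i)> = 0], which is the recurrence.

   Uniqueness: remove one particle from a site with at least two. Putting it back at the successive
   sites of the maximal interval of occupied sites turns the recurrence into
   [(q + 1) g_j = q g_(j-1) + g_(j+1)], whose solutions are determined by their two end values, and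
   there one more site is occupied (or the value is 0). *)
Require Import Defs.
From HB Require Import structures.
From mathcomp Require Import all_boot all_order all_algebra all_fingroup.
From mathcomp Require Import fraction.
From mathcomp Require Import mpoly.
From mathcomp Require Import zify ring.
From Stdlib Require Import ClassicalEpsilon.
Import GRing.Theory.
Local Open Scope ring_scope.
Set Implicit Arguments. Unset Strict Implicit. Unset Printing Implicit Defensive.

(** * Inversions and reduced words *)

Section Inversions.
Variable n : nat.
Implicit Types (w : 'S_n) (a b : 'I_n) (s : seq nat).

Definition ninv w : nat :=
  \sum_(p : 'I_n * 'I_n | (p.1 < p.2)%N) (w p.2 < w p.1)%N.

Lemma ninv1 : ninv 1 = 0%N.
Proof. by rewrite /ninv big1 // => p lt12; rewrite !perm1 ltnNge ltnW. Qed.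

Lemma adjE a b : b = a.+1 :> nat -> adj n a = tperm a b.
Proof. by move=> ab; rewrite /adj valK -ab valK. Qed.

Lemma adjK j : (adj n j * adj n j = 1)%g.
Proof. by rewrite /adj; case: insub => [a|]; [case: insub => [b|]|]; rewrite ?tperm2 ?mulg1. Qed.

Lemma adjMK j w : (adj n j * (adj n j * w))%g = w.
Proof. by rewrite mulgA adjK mul1g. Qed.

Lemma tperm_swap_inj (s : 'S_n) : injective (fun p : 'I_n * 'I_n => (s p.1, s p.2)).
Proof. by move=> [x y] [x' y'] /= [/perm_inj-> /perm_inj->]. Qed.

(* A simple transposition permutes the increasing pairs other than the one it exchanges. *)
Lemma tperm_lt_pairs a b (p : 'I_n * 'I_n) (s := tperm a b) : b = a.+1 :> nat ->
  ((s p.1 < s p.2)%N && ((s p.1, s p.2) != (a, b))) = ((p.1 < p.2)%N && (p != (a, b))).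
Proof.
case: p => x y /= ab; rewrite !xpair_eqE /s -!(inj_eq val_inj) /=.
by case: tpermP => [->|->|/eqP + /eqP]; case: tpermP => [->|->|/eqP + /eqP];
  rewrite -?(inj_eq val_inj) /= ?ab; lia.
Qed.

(** Only the pair [(a, b)] changes status; by [tperm_lt_pairs] the transposition permutes the other
    increasing pairs, so their inversions match. *)
Lemma ninv_adj_up w a b : b = a.+1 :> nat -> (w a < w b)%N ->
  ninv (adj n a * w) = (ninv w).+1.
Proof.
move=> ab lt_w; have ltab : (a < b)%N by rewrite ab.
rewrite (adjE ab) /ninv (bigD1 (a, b)) //= !permM tpermL tpermR lt_w add1n.
congr _.+1; rewrite [RHS](bigD1 (a, b)) //= ltnNge ltnW // add0n.
rewrite [RHS](reindex_inj (@tperm_swap_inj (tperm a b))) /=.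
by apply: eq_big => [p|p _]; rewrite ?tperm_lt_pairs // !permM.
Qed.

Lemma ninv_adj_down w a b : b = a.+1 :> nat -> (w b < w a)%N ->
  ninv w = (ninv (adj n a * w)).+1.
Proof.
move=> ab lt_w; rewrite -(@ninv_adj_up _ a b) ?adjMK //.
by rewrite (adjE ab) !permM tpermL tpermR.
Qed.

(** Products act from left to right, so multiplying by [adj n j] on the left exchanges the values at
    positions [j] and [j.+1]; descents are therefore taken at positions. *)
Definition desc w (j : nat) : bool :=
  match insub j, insub j.+1 with
  | Some a, Some b => (w b < w a)%N
  | _, _ => false
  end.

Lemma descE w a b : b = a.+1 :> nat -> desc w a = (w b < w a)%N.
Proof. by move=> ab; rewrite /desc valK -ab valK. Qed.

Lemma ord_pair {j} : (j.+1 < n)%N -> exists a b : 'I_n, b = a.+1 :> nat /\ j = a.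
Proof. by move=> ltj; exists (Ordinal (ltnW ltj)), (Ordinal ltj). Qed.

Lemma ninv_adj w j : (j.+1 < n)%N ->
  if desc w j then ninv w = (ninv (adj n j * w)).+1
  else ninv (adj n j * w) = (ninv w).+1.
Proof.
move=> /ord_pair[a [b [ab ->]]]; rewrite (descE _ ab).
case: ltngtP => [lt_w|lt_w|/val_inj/perm_inj E]; [exact: ninv_adj_down lt_w|exact: ninv_adj_up lt_w|].
by move: ab; rewrite E; lia.
Qed.

Lemma desc_adj w j : (j.+1 < n)%N -> desc (adj n j * w) j = ~~ desc w j.
Proof.
move=> ltj; have := ninv_adj w ltj; have := ninv_adj (adj n j * w) ltj.
by rewrite adjMK; do 2 case: desc => //; lia.
Qed.

(** Without descents [w] is increasing, which forces [m <= w m] by induction from the bottom and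
    [w a <= a] by induction from the top. *)
Lemma no_desc_id w : (forall j, (j.+1 < n)%N -> ~~ desc w j) -> w = 1%g.
Proof.
move=> nd.
have mono k a : forall b, b = (a + k.+1)%N :> nat -> (w a < w b)%N.
  elim: k => [|k IHk] b abk.
    have ab : b = a.+1 :> nat by lia.
    have := nd a; rewrite -ab (descE _ ab) => /(_ (ltn_ord b)); rewrite -leqNgt leq_eqVlt.
    by case/orP => // /eqP/val_inj/perm_inj E; move: ab; rewrite E; lia.
  have ltc : (a + k.+1 < n)%N by have := ltn_ord b; lia.
  pose c := Ordinal ltc.
  have cb : b = c.+1 :> nat by rewrite /= abk; lia.
  have := IHk c erefl; have := nd c; rewrite -cb (descE _ cb) => /(_ (ltn_ord b)).
  rewrite -leqNgt leq_eqVlt => /orP[/eqP/val_inj/perm_inj E|]; last by lia.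
  by move: cb; rewrite E; lia.
have ge m : forall a, a = m :> nat -> (m <= w a)%N.
  elim: m => // m IHm a am.
  have ltm : (m < n)%N by have := ltn_ord a; lia.
  have := IHm (Ordinal ltm) erefl; have := @mono 0 (Ordinal ltm) a; rewrite /= addn1 am.
  by move=> /(_ erefl); lia.
have le m : forall a, (n - a.+1 = m)%N -> (w a <= a)%N.
  elim: m => [|m IHm] a am; first by have := ltn_ord (w a); have := ltn_ord a; lia.
  have ltb : (a.+1 < n)%N by lia.
  have := IHm (Ordinal ltb); have := @mono 0 a (Ordinal ltb); rewrite /= addn1.
  by move=> /(_ erefl) + /(_ ltac:(lia)); lia.
apply/permP => a; rewrite perm1; apply/val_inj/eqP; rewrite eqn_leq.
by rewrite (le _ _ erefl) (ge _ _ erefl).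
Qed.

Lemma word_perm_cons j s : word_perm n (j :: s) = (adj n j * word_perm n s)%g.
Proof. by rewrite /word_perm big_cons. Qed.

Lemma ninv_word s : word_ok n s -> (ninv (word_perm n s) <= size s)%N.
Proof.
elim: s => [|j s IHs] /=; first by rewrite /word_perm big_nil ninv1.
case/andP=> ltj /IHs le_s; rewrite word_perm_cons.
by have := ninv_adj (word_perm n s) ltj; case: desc; lia.
Qed.

(** Bubble sort: removing a descent lowers [ninv] by one, and only the identity has none. *)
Lemma exists_word w :
  exists s, [/\ word_ok n s, word_perm n s = w & size s = ninv w].
Proof.
have [m] := ubnP (ninv w); elim: m w => // m IHm w lt_wm.
have [[j /andP[ltj dj]]|nd] := altP (@existsP _ (fun j : 'I_n => (j.+1 < n)%N && desc w j)).
  have := ninv_adj w ltj; rewrite dj => ew.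
  have [|s [ok_s ws szs]] := IHm (adj n j * w)%g; first by lia.
  by exists (val j :: s); split; rewrite /= ?ltj // ?word_perm_cons ?ws ?adjMK // szs ew.
exists [::]; suff -> : w = 1%g by rewrite /word_perm big_nil ninv1.
apply: no_desc_id => j ltj; move: nd; rewrite negb_exists => /forallP/(_ (Ordinal (ltnW ltj))).
by rewrite /= ltj.
Qed.

(** Choice returns a word of minimal length; [exists_word] and [ninv_word] identify that length with
    [ninv w]. *)
Lemma rwordP w : [/\ word_ok n (rword w), word_perm n (rword w) = w & size (rword w) = ninv w].
Proof.
have [s [ok_s ws szs]] := exists_word w.
have : reduced_word w (rword w).
  apply: (epsilon_spec (inhabits [::]) (reduced_word w)); exists s; split=> // s' ok' ws'.
  by rewrite szs -ws' ninv_word.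
case=> ok_r wr min_r; split=> //; apply/eqP; rewrite eqn_leq -{1}szs min_r //=.
by rewrite -{1}wr ninv_word.
Qed.

End Inversions.

(** * Matsumoto's theorem *)

Section Matsumoto.
Variable n : nat.
Implicit Types (w : 'S_n) (s : seq nat).

Lemma desc_adj_far w i j : (i.+1 < n)%N -> (j.+1 < n)%N -> (i.+1 < j)%N || (j.+1 < i)%N ->
  desc (adj n i * w) j = desc w j.
Proof.
move=> /ord_pair[a [b [ab ->]]] /ord_pair[c [d [cd ->]]] far.
rewrite !(descE _ cd) (adjE ab) !permM.
by rewrite !tpermD // -(inj_eq val_inj) /=; lia.
Qed.

(** Two neighbouring descents mean three decreasing values, so either way of sorting them removes a
    descent at every step. *)
Lemma desc_adj_near w i : (i.+2 < n)%N -> desc w i -> desc w i.+1 ->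
  [/\ desc (adj n i * w) i.+1, desc (adj n i.+1 * (adj n i * w)) i,
      desc (adj n i.+1 * w) i & desc (adj n i * (adj n i.+1 * w)) i.+1].
Proof.
move=> lti; have [a [b [ab ea]]] := ord_pair (ltnW lti).
have [b' [c [bc eb]]] := ord_pair lti; have {b' bc eb} bc : c = b.+1 :> nat by lia.
have [eb ec] : i.+1 = b /\ i.+2 = c by lia.
rewrite eb ea !(descE _ ab) !(descE _ bc) (adjE ab) (adjE bc).
have [nab nbc nac] : [/\ a != b, b != c & a != c] by rewrite -!(inj_eq val_inj) /=; split; lia.
have [Ec Ea] : tperm a b c = c /\ tperm b c a = a by rewrite !tpermD // eq_sym.
by rewrite !permM !(Ea, Ec, tpermL, tpermR) => ? ?; split=> //; lia.
Qed.

Definition reduced s := word_ok n s /\ size s = ninv (word_perm n s).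

Lemma reduced_consP j s :
  reduced (j :: s) <-> [/\ (j.+1 < n)%N, reduced s & desc (adj n j * word_perm n s) j].
Proof.
rewrite /reduced word_perm_cons /=; split.
  case=> /andP[ltj ok_s] sz; have := ninv_word ok_s; have := ninv_adj (word_perm n s) ltj.
  by rewrite desc_adj //; case: ifP => _ ? ?; split=> //; try split; lia.
case=> ltj [ok_s sz]; rewrite desc_adj // => nd; have := ninv_adj (word_perm n s) ltj.
by rewrite (negPf nd) ltj; split=> //; lia.
Qed.

Lemma exists_reduced w : exists2 s, reduced s & word_perm n s = w.
Proof. by have [s [ok_s ws sz]] := exists_word w; exists s => //; rewrite /reduced ws. Qed.

Variables (U : Type) (T : nat -> U -> U).
Hypothesis commT : forall i j u, (i.+1 < j)%N -> (j.+1 < n)%N -> T i (T j u) = T j (T i u).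
Hypothesis braidT : forall i u, (i.+2 < n)%N ->
  T i (T i.+1 (T i u)) = T i.+1 (T i (T i.+1 u)).

(** Matsumoto's theorem, by induction on the length. Equal first letters cancel. Distinct first
    letters [i] and [j] are both descents of the common permutation, and the words are compared with
    two words that start with the two sides of a commutation or braid relation. *)
Lemma reduced_word_foldr s s' u : reduced s -> reduced s' -> word_perm n s = word_perm n s' ->
  foldr T u s = foldr T u s'.
Proof.
have [m] := ubnP (size s); elim: m s s' u => // m IHm s s' u.
suff step i j a b : (i < j)%N -> (size a < m)%N -> reduced (i :: a) -> reduced (j :: b) ->
    word_perm n (i :: a) = word_perm n (j :: b) ->
    foldr T u (i :: a) = foldr T u (j :: b).
  move=> lt_sm rs rs' E; have Esz : size s = size s' by rewrite rs.2 rs'.2 E.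
  case: s s' Esz lt_sm rs rs' E => [|i a] [|j b] // [Esz] lt_sm ria rjb E.
  have [lt_ij|lt_ji|Eij] := ltngtP i j; first exact: step.
    by apply/esym; apply: step => //; rewrite -Esz.
  subst j; rewrite /=; congr T; move: ria rjb => /reduced_consP[_ ra _] /reduced_consP[_ rb _].
  by apply: IHm => //; move: E; rewrite !word_perm_cons => /mulgI.
move=> lt_ij lt_am /reduced_consP[lti ra di] /reduced_consP[ltj rb dj].
rewrite !word_perm_cons => E.
have szb : size b = size a.
  rewrite ra.2 rb.2; have := ninv_adj (word_perm n a) lti; have := ninv_adj (word_perm n b) ltj.
  by move: di dj; rewrite !desc_adj // => /negPf-> /negPf->; rewrite E; lia.
have Ea : word_perm n a = (adj n i * (adj n j * word_perm n b))%g by rewrite -E adjMK.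
have Eb : word_perm n b = (adj n j * (adj n i * word_perm n a))%g by rewrite E adjMK.
have djw : desc (adj n i * word_perm n a) j by rewrite E.
have [far|near] := ltnP i.+1 j.
  (* [c] spells the permutation with both descents removed, so by induction [a] may be replaced by
     [j :: c] and [b] by [i :: c]. *)
  have [c rc wc] := exists_reduced (adj n j * word_perm n a)%g.
  have wjc : word_perm n (j :: c) = word_perm n a by rewrite word_perm_cons wc adjMK.
  have comm : (adj n i * (adj n j * word_perm n a) = word_perm n b)%g.
    rewrite Eb !mulgA; congr (_ * _)%g.
    have [x [y [xy Ei]]] := ord_pair lti; have [z [t [zt Ez]]] := ord_pair ltj.
    rewrite Ei Ez (adjE xy) (adjE zt).
    have [nxz nxt nyz nyt] : [/\ x != z, x != t, y != z & y != t].
      by rewrite -!(inj_eq val_inj) /=; split; lia.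
    have [Dx Dy] : tperm z t x = x /\ tperm z t y = y by rewrite !tpermD // eq_sym.
    have [Dz Dt] : tperm x y z = z /\ tperm x y t = t by rewrite !tpermD.
    apply/permP => v; rewrite !permM.
    case: (eqVneq v x) => [->|nvx]; first by rewrite !(Dx, Dy, tpermL).
    case: (eqVneq v y) => [->|nvy]; first by rewrite !(Dx, Dy, tpermR).
    case: (eqVneq v z) => [->|nvz]; first by rewrite !(Dz, Dt, tpermL).
    case: (eqVneq v t) => [->|nvt]; first by rewrite !(Dz, Dt, tpermR).
    by rewrite !tpermD // eq_sym.
  have wic : word_perm n (i :: c) = word_perm n b by rewrite word_perm_cons wc.
  have rjc : reduced (j :: c).
    by apply/reduced_consP; split; rewrite // wc adjMK -(@desc_adj_far _ i) // far.
  have ric : reduced (i :: c).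
    apply/reduced_consP; split; rewrite // -word_perm_cons wic.
    by rewrite -(@desc_adj_far _ j) -?E ?far ?orbT.
  rewrite /= (IHm a (j :: c)) // (IHm b (i :: c)) ?szb //=.
  exact: commT.
have {lt_ij near} Ej : j = i.+1 by lia.
subst j; have [d1 d2 d3 d4] := desc_adj_near ltj di djw.
rewrite adjMK in d1 d2; rewrite E adjMK in d3 d4.
have braid : (adj n i * (adj n i.+1 * word_perm n a) = adj n i.+1 * (adj n i * word_perm n b))%g.
  rewrite Ea !mulgA; congr (_ * _)%g.
  have [x [y [xy Ei]]] := ord_pair lti; have [y' [z [yz Ey']]] := ord_pair ltj.
  have {y' yz Ey'} [yz Ey] : z = y.+1 :> nat /\ i.+1 = y by lia.
  rewrite Ey Ei (adjE xy) (adjE yz).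
  have [nxy nyz nxz] : [/\ x != y, y != z & x != z] by rewrite -!(inj_eq val_inj) /=; split; lia.
  apply/permP => v; rewrite !permM.
  have [Ez Ex] : tperm x y z = z /\ tperm y z x = x by rewrite !tpermD // eq_sym.
  case: (eqVneq v x) => [->|nvx]; first by rewrite !(Ex, Ez, tpermL, tpermR).
  case: (eqVneq v y) => [->|nvy]; first by rewrite !(Ex, Ez, tpermL, tpermR).
  case: (eqVneq v z) => [->|nvz]; first by rewrite !(Ex, Ez, tpermL, tpermR).
  by rewrite !tpermD // eq_sym.
(* [c] spells the permutation with its three values sorted; [a] becomes [i.+1 :: i :: c] and [b]
   becomes [i :: i.+1 :: c]. *)
have [c rc wc] := exists_reduced (adj n i * (adj n i.+1 * word_perm n a))%g.
have ric : reduced (i :: c) by apply/reduced_consP; split; rewrite // wc adjMK.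
have rjc : reduced (i.+1 :: c) by apply/reduced_consP; split; rewrite // wc braid adjMK.
have rjic : reduced (i.+1 :: i :: c).
  by apply/reduced_consP; split; rewrite // word_perm_cons wc !adjMK.
have rijc : reduced (i :: i.+1 :: c).
  by apply/reduced_consP; split; rewrite // word_perm_cons wc braid !adjMK.
rewrite /= (IHm a (i.+1 :: i :: c)) // ?word_perm_cons ?wc ?adjMK //.
rewrite (IHm b (i :: i.+1 :: c)) // ?szb // ?word_perm_cons ?wc ?braid ?adjMK //=.
exact: braidT.
Qed.

End Matsumoto.

(** * The sum of the Demazure-Lusztig operators *)

Section DemazureLusztig.
Variables (K : fieldType) (q : K).
(** The coefficients in [T g = dlA x y * g + dlB x y * s g], where [s] exchanges [x] and [y]; see
    [dl_expand]. *)
Definition dlA (x y : K) : K := (q - 1) * x / (x - y).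
Definition dlB (x y : K) : K := (x - q * y) / (x - y).

(** The braid relation with both sides expanded. The images of [g] under words in the two
    transpositions are treated as independent unknowns, so it is an identity of rational
    functions. *)
Lemma dl_braid (x y z g g1 g2 g12 g21 g121 : K) :
  x - y != 0 -> y - z != 0 -> x - z != 0 ->
  dlA x y * (dlA y z * (dlA x y * g + dlB x y * g1) + dlB y z * (dlA x z * g2 + dlB x z * g21))
  + dlB x y * (dlA x z * (dlA y x * g1 + dlB y x * g) + dlB x z * (dlA y z * g12 + dlB y z * g121))
  = dlA y z * (dlA x y * (dlA y z * g + dlB y z * g2) + dlB x y * (dlA x z * g1 + dlB x z * g12))
  + dlB y z * (dlA x z * (dlA z y * g2 + dlB z y * g) + dlB x z * (dlA x y * g21 + dlB x y * g121)).
Proof.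
move=> xy yz xz; have yx : y - x != 0 by rewrite -opprB oppr_eq0.
have zy : z - y != 0 by rewrite -opprB oppr_eq0.
by rewrite /dlA /dlB; field; rewrite xy yz xz yx zy.
Qed.

Lemma dl_quadratic (x y g g1 : K) : x - y != 0 ->
  dlA x y * (dlA x y * g + dlB x y * g1) + dlB x y * (dlA y x * g1 + dlB y x * g)
  = (q - 1) * (dlA x y * g + dlB x y * g1) + q * g.
Proof.
move=> xy; have yx : y - x != 0 by rewrite -opprB oppr_eq0.
by rewrite /dlA /dlB; field; rewrite xy yx.
Qed.

(** An eigenvector of [T] for the eigenvalue [q] is fixed by the transposition, because
    [(x - q y) (g1 - g) = (x - y) (T g - q g)]. *)
Lemma dl_fixed (x y g g1 : K) : x - y != 0 -> x - q * y != 0 ->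
  dlA x y * g + dlB x y * g1 = q * g -> g1 = g.
Proof.
move=> xy xqy E; apply/eqP; rewrite -subr_eq0 -(mulrI_eq0 _ (mulfI xqy)).
have -> : (x - q * y) * (g1 - g) = (x - y) * (dlA x y * g + dlB x y * g1 - q * g).
  by rewrite /dlA /dlB; field.
by rewrite E subrr mulr0.
Qed.
End DemazureLusztig.

(** The first value [j] exceeds exactly [j] others, all of them to its right; the remaining
    inversions are those of [s]. *)
Lemma ninv_lift_perm n (j : 'I_n.+1) (s : 'S_n) :
  ninv (lift_perm ord0 j s) = (j + ninv s)%N.
Proof.
have ninvE m (w : 'S_m) : ninv w = (\sum_(a < m) \sum_(b < m) ((a < b) && (w b < w a)))%N.
  rewrite /ninv -(pair_big_dep predT (fun a b : 'I_m => (a < b)%N)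
    (fun a b : 'I_m => nat_of_bool (w b < w a)%N)) /=.
  by apply: eq_bigr => a _; rewrite big_mkcond; apply: eq_bigr => b _; case: ifP.
rewrite !ninvE big_ord_recl; congr (_ + _)%N.
  rewrite big_ord_recl /= add0n (eq_bigr (fun b : 'I_n => nat_of_bool (s b < j)%N)).
    transitivity (\sum_(c < n) (c < j))%N; first by rewrite [RHS](reindex_perm s).
    rewrite -big_mkcond /= big_ord_narrow; first by rewrite -ltnS.
    by rewrite sum1_card card_ord.
  move=> b _; rewrite lift_perm_id lift_perm_lift /= /bump.
  by congr nat_of_bool; lia.
apply: eq_bigr => a _; rewrite big_ord_recl /= add0n; apply: eq_bigr => b _.
rewrite !lift_perm_lift /= /bump; congr nat_of_bool; lia.
Qed.

(** A permutation is split into its first value, which contributes a factor [qint q n.+1], and the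
    pattern of the others. *)
Lemma sum_expr_ninv (K : fieldType) (q : K) n : \sum_(w : 'S_n) q ^+ ninv w = qfact q n.
Proof.
elim: n => [|n IHn].
  rewrite /qfact big_ord0 (big_pred1 1%g) ?ninv1 // => w.
  by apply/esym/eqP/permP => -[].
pose f (p : 'I_n.+1 * 'S_n) := lift_perm ord0 p.1 p.2.
have f_inj : injective f.
  move=> [i s] [j t] E; have Eij : i = j by rewrite -(lift_perm_id ord0 i s) [lift_perm _ _ _]E lift_perm_id.
  subst j; congr (_, _); apply/permP => c; apply: (@lift_inj _ i).
  by rewrite -(lift_perm_lift ord0) [lift_perm _ _ _]E lift_perm_lift.
have f_bij : bijective f.
  by apply: inj_card_bij f_inj _; rewrite card_prod card_ord !card_Sn factS.
rewrite (reindex f) /=; last exact: onW_bij.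
rewrite /qfact big_ord_recr /= -/(qfact q n) -IHn mulrC /qint big_distrlr /=.
by rewrite pair_big; apply: eq_bigr => p _; rewrite ninv_lift_perm exprD.
Qed.

(** * Hecke relations, the sum of all [T_w] and the symmetrizer *)

Section HeckeAction.
Variables (n : nat) (K : fieldType) (act : 'S_n -> {rmorphism K -> K}).
Variables (x : 'I_n -> K) (q : K) (T : nat -> K -> K).
Hypothesis actM : forall s t g, act (s * t)%g g = act t (act s g).
Hypothesis act1 : forall g, act 1%g g = g.
Hypothesis act_x : forall s i, act s (x i) = x (s i).
Hypothesis act_q : forall s, act s q = q.
Hypothesis x_neq : forall i j, i != j -> x i - x j != 0.
Hypothesis xq_neq : forall i j, i != j -> x i - q * x j != 0.
Local Notation al := (dlA q).
Local Notation be := (dlB q).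
Hypothesis TE : forall (a b : 'I_n) g, b = a.+1 :> nat ->
  T a g = al (x a) (x b) * g + be (x a) (x b) * act (tperm a b) g.
Implicit Types (a b : 'I_n) (g : K) (w : 'S_n).

(** Abstract form of [Tw], convertible to it when [T] is [Top]. *)
Definition Tword w g : K := foldr T g (rword w).

Lemma act_dlA s a b : act s (al (x a) (x b)) = al (x (s a)) (x (s b)).
Proof. by rewrite /dlA !(rmorphM, rmorphB, fmorphV, rmorph1) /= !act_x act_q. Qed.

Lemma act_dlB s a b : act s (be (x a) (x b)) = be (x (s a)) (x (s b)).
Proof. by rewrite /dlB !(rmorphM, rmorphB, fmorphV) /= !act_x act_q. Qed.

Lemma Top_comm i j g : (i.+1 < j)%N -> (j.+1 < n)%N -> T i (T j g) = T j (T i g).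
Proof.
move=> ij ltj; have [a [b [ab Ei]]] : exists a b : 'I_n, b = a.+1 :> nat /\ i = a.
  by apply: ord_pair; lia.
have [c [d [cd Ej]]] := ord_pair ltj; rewrite {}Ei {}Ej in ij *.
have [nac nad nbc nbd] : [/\ a != c, a != d, b != c & b != d].
  by rewrite -!(inj_eq val_inj) /=; split; lia.
have [Ea Eb] : tperm c d a = a /\ tperm c d b = b by rewrite !tpermD // eq_sym.
have [Ec Ed] : tperm a b c = c /\ tperm a b d = d by rewrite !tpermD.
rewrite !(TE _ ab) !(TE _ cd) !(act_dlA, act_dlB, rmorphD, rmorphM) Ea Eb Ec Ed.
rewrite -!actM; have -> : (tperm a b * tperm c d = tperm c d * tperm a b)%g.
  apply/permP => v; rewrite !permM.
  case: (eqVneq v a) => [->|nva]; first by rewrite !(Ea, Eb, tpermL).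
  case: (eqVneq v b) => [->|nvb]; first by rewrite !(Ea, Eb, tpermR).
  case: (eqVneq v c) => [->|nvc]; first by rewrite !(Ec, Ed, tpermL).
  case: (eqVneq v d) => [->|nvd]; first by rewrite !(Ec, Ed, tpermR).
  by rewrite !tpermD // eq_sym.
move: (al _ _) (be _ _) (al _ _) (be _ _) (act _ g) (act _ g) (act _ g) => *.
by ring.
Qed.

Lemma Top_braid i g : (i.+2 < n)%N -> T i (T i.+1 (T i g)) = T i.+1 (T i (T i.+1 g)).
Proof.
move=> lti; have [a [b [ab ea]]] := ord_pair (ltnW lti).
have [b' [c [bc eb]]] := ord_pair lti; have {b' bc eb} bc : c = b.+1 :> nat by lia.
have [eb ec] : i.+1 = b /\ i.+2 = c by lia.
rewrite eb ea; have [nab nbc nac] : [/\ a != b, b != c & a != c].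
  by rewrite -!(inj_eq val_inj) /=; split; lia.
have [Ec Ea] : tperm a b c = c /\ tperm b c a = a by rewrite !tpermD // eq_sym.
rewrite !(TE _ ab) !(TE _ bc).
rewrite !(act_dlA, act_dlB, rmorphD, rmorphM, Ea, Ec, tpermL, tpermR).
have idp s h : act (tperm s h) (act (tperm s h) g) = g by rewrite -actM tperm2 act1.
rewrite !idp; have -> : act (tperm b c) (act (tperm a b) (act (tperm b c) g)) =
                        act (tperm a b) (act (tperm b c) (act (tperm a b) g)).
  have E : (tperm b c * tperm a b * tperm b c = tperm a b * tperm b c * tperm a b)%g; last first.
    by rewrite -!actM !mulgA E.
  apply/permP => v; rewrite !permM.
  case: (eqVneq v a) => [->|nva]; first by rewrite !(Ea, Ec, tpermL, tpermR).
  case: (eqVneq v b) => [->|nvb]; first by rewrite !(Ea, Ec, tpermL, tpermR).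
  case: (eqVneq v c) => [->|nvc]; first by rewrite !(Ea, Ec, tpermL, tpermR).
  by rewrite !tpermD // eq_sym.
by apply: dl_braid; apply: x_neq.
Qed.

Lemma Top_quadratic j g : (j.+1 < n)%N -> T j (T j g) = (q - 1) * T j g + q * g.
Proof.
move=> /ord_pair[a [b [ab ->]]]; rewrite !(TE _ ab) !(act_dlA, act_dlB, rmorphD, rmorphM).
rewrite !(tpermL, tpermR) -actM tperm2 act1.
by apply: dl_quadratic; apply: x_neq; rewrite -(inj_eq val_inj) /=; lia.
Qed.

Lemma Tw_reduced w s g : reduced n s -> word_perm n s = w -> Tword w g = foldr T g s.
Proof.
have [ok_r wr sz_r] := rwordP w => rs ws; rewrite /Tword.
apply: (reduced_word_foldr (n := n)) rs _; [exact: Top_comm|exact: Top_braid| |by rewrite ws].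
by split; rewrite // wr.
Qed.

Lemma Top_Tw j w g : (j.+1 < n)%N -> ~~ desc w j -> T j (Tword w g) = Tword (adj n j * w) g.
Proof.
move=> ltj nd; have [s rs ws] := exists_reduced w.
rewrite (Tw_reduced g rs ws) (@Tw_reduced _ (j :: s)) ?word_perm_cons ?ws //.
by apply/reduced_consP; rewrite ws desc_adj.
Qed.

Lemma Top_is_zmod_morphism j : (j.+1 < n)%N -> zmod_morphism (T j).
Proof.
move=> /ord_pair[a [b [ab ->]]] g h; rewrite !(TE _ ab) rmorphB /=.
move: (al _ _) (be _ _) (act _ g) (act _ h) => *; by ring.
Qed.

Definition Tsum g : K := \sum_(w : 'S_n) Tword w g.

Lemma Top_sum j (I : Type) (r : seq I) (P : pred I) (E : I -> K) : (j.+1 < n)%N ->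
  T j (\sum_(i <- r | P i) E i) = \sum_(i <- r | P i) T j (E i).
Proof.
move=> ltj; have TB := Top_is_zmod_morphism ltj.
have T0 : T j 0 = 0 by rewrite -[X in T j X](subrr 0) TB subrr.
have TD g h : T j (g + h) = T j g + T j h.
  by rewrite -{1}[h]opprK TB -[- h]sub0r TB T0 sub0r opprK.
exact: (big_morph _ TD T0).
Qed.

(** Pair each [w] without descent at [j] with [w' = adj n j * w]. Then [T_j] sends [T_w] to [T_w']
    and, by the quadratic relation, [T_w'] to [(q - 1) T_w' + q T_w], so the sum over each pair is
    multiplied by [q]. *)
Lemma Top_Tsum j g : (j.+1 < n)%N -> T j (Tsum g) = q * Tsum g.
Proof.
move=> ltj; rewrite /Tsum Top_sum //.
have adj_inj : injective (fun w : 'S_n => (adj n j * w)%g) by move=> u v /mulgI.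
rewrite (bigID (fun w => desc w j)) /=.
have desc_sum (E : 'S_n -> K) :
    \sum_(w | desc w j) E w = \sum_(w | ~~ desc w j) E (adj n j * w)%g.
  by rewrite (reindex_inj adj_inj); apply: eq_bigl => w; rewrite desc_adj.
rewrite [X in _ + X](eq_bigr (fun w => Tword (adj n j * w) g)); last first.
  by move=> w nd; rewrite Top_Tw.
rewrite -(desc_sum (fun w => Tword w g)).
rewrite (eq_bigr (fun w => (q - 1) * Tword w g + q * Tword (adj n j * w) g)); last first.
  move=> w dw; rewrite -{1}(adjMK j w) -Top_Tw ?desc_adj ?dw // Top_quadratic //.
  by rewrite Top_Tw ?desc_adj ?dw // adjMK.
rewrite big_split /= -!mulr_sumr (desc_sum (fun w => Tword (adj n j * w) g)).
under [X in _ + q * X + _]eq_bigr do rewrite adjMK.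
rewrite [in RHS](bigID (fun w => desc w j)) /=.
move: (\sum_(_ | _) _) (\sum_(_ | _) _) => D A; by ring.
Qed.

Lemma act_Tsum s g : act s (Tsum g) = Tsum g.
Proof.
have adj_fix j : (j.+1 < n)%N -> act (adj n j) (Tsum g) = Tsum g.
  move=> ltj; have := Top_Tsum g ltj; have [a [b [ab ->]]] := ord_pair ltj.
  have ne : a != b by rewrite -(inj_eq val_inj) /=; lia.
  rewrite (TE _ ab) (adjE ab) => /dl_fixed; apply; [exact: x_neq|exact: xq_neq].
have [t [ok_t <- _]] := exists_word s; elim: t ok_t => [|j t IHt] /=.
  by rewrite /word_perm big_nil act1.
by case/andP=> ltj /IHt E; rewrite word_perm_cons actM adj_fix.
Qed.

Definition weight : K :=
  \prod_(p : 'I_n * 'I_n | (p.1 < p.2)%N) ((x p.2 - q * x p.1) / (x p.2 - x p.1)).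

Definition symmetrizer g : K := \sum_w act w (g * weight).

(** Without its factor for [(a, b)], [weight] is fixed by the transposition [s]. Replacing [w] by
    [s * w] in the half that contains [act s g] leaves an identity between the coefficients in [x a]
    and [x b]. *)
Lemma symmetrizer_Top j g : (j.+1 < n)%N -> symmetrizer (T j g) = q * symmetrizer g.
Proof.
move=> /ord_pair[a [b [ab ->]]]; have ltab : (a < b)%N by rewrite ab.
have nab : a != b by rewrite -(inj_eq val_inj) /=; lia.
have xab := x_neq nab; have xba : x b - x a != 0 by rewrite -opprB oppr_eq0.
pose s := tperm a b; pose w' : K :=
  \prod_(p : 'I_n * 'I_n | (p.1 < p.2)%N && (p != (a, b)))
    ((x p.2 - q * x p.1) / (x p.2 - x p.1)).
have wE : weight = (x b - q * x a) / (x b - x a) * w' by rewrite /weight (bigD1 (a, b)).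
have w'_fixed : act s w' = w'.
  rewrite /w' rmorph_prod /= [RHS](reindex_inj (@tperm_swap_inj _ s)) /=.
  apply: eq_big => [p|p _]; first by rewrite tperm_lt_pairs.
  by rewrite !(rmorphM, rmorphB, fmorphV) /= act_q !act_x.
rewrite /symmetrizer mulr_sumr.
rewrite [RHS](eq_bigr (fun w => act w (q * (g * weight)))); last first.
  by move=> w _; rewrite [RHS]rmorphM act_q.
rewrite (eq_bigr (fun w => act w (dlA q (x a) (x b) * g * weight)
    + act w (dlB q (x a) (x b) * act s g * weight))); last first.
  by move=> w _; rewrite (TE _ ab) mulrDl rmorphD.
rewrite big_split /= [X in _ + X](reindex_inj (mulgI s)) -big_split /=.
apply: eq_bigr => w _; rewrite actM -rmorphD; apply: (congr1 (act w)).
rewrite !(act_dlB, rmorphM) -actM tperm2 act1 tpermL tpermR wE.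
rewrite !(rmorphM, rmorphB, fmorphV, act_q, act_x) w'_fixed tpermL tpermR /dlA /dlB.
move: w' {wE w'_fixed} => v; field.
by rewrite xab xba.
Qed.

Lemma symmetrizer_Tw w g : symmetrizer (Tword w g) = q ^+ ninv w * symmetrizer g.
Proof.
have [ok_r _ <-] := rwordP w; rewrite /Tword; elim: (rword w) ok_r => [|j s IHs] /=.
  by rewrite expr0 mul1r.
by case/andP=> ltj /IHs E; rewrite symmetrizer_Top // E exprS mulrA.
Qed.

(** Two computations of [symmetrizer (Tsum g)]: a symmetric argument factors out and leaves
    [symmetrizer 1], while termwise each [T_w] contributes [q ^+ ninv w]. The value of
    [symmetrizer 1] is a premise because it comes from alternants. *)
Lemma Tsum_symmetrizer g : symmetrizer 1 = qfact q n -> qfact q n != 0 ->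
  Tsum g = symmetrizer g.
Proof.
move=> X1 nz; apply: (mulIf nz); rewrite -{1}X1 mulrC.
transitivity (symmetrizer (Tsum g)).
  rewrite /symmetrizer mulr_suml; apply: eq_bigr => w _.
  by rewrite mul1r rmorphM /= act_Tsum mulrC.
rewrite -sum_expr_ninv mulr_sumr {1}/symmetrizer.
under eq_bigr => w _ do rewrite /Tsum mulr_suml rmorph_sum /=.
by rewrite exchange_big /=; apply: eq_bigr => w _; rewrite -/(symmetrizer _) symmetrizer_Tw mulrC.
Qed.

End HeckeAction.

(** * Permutations acting on rational functions *)

Lemma fraction_repr (R : idomainType) (x : {fraction R}) :
  x = (\n_(generic_quotient.repr x))%:F / (\d_(generic_quotient.repr x))%:F.
Proof.
have dP := denom_ratioP (generic_quotient.repr x).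
rewrite -{1}[x]generic_quotient.reprK; move: (generic_quotient.repr x) dP => y dP.
unlock FracField.tofrac.
rewrite -[X in _ = _ * X]FracField.pi_inv -[RHS]FracField.pi_mul /FracField.invf /FracField.mulf.
rewrite !numden_Ratio ?oner_neq0 // mulr1 mul1r.
by rewrite FracField.Ratio_numden.
Qed.

Lemma denom_repr_neq0 (R : idomainType) (x : {fraction R}) :
  (\d_(generic_quotient.repr x))%:F != 0.
Proof. by rewrite tofrac_eq0 denom_ratioP. Qed.

Lemma fractionW (R : idomainType) (P : {fraction R} -> Prop) :
  (forall a b, b != 0 -> P (a%:F / b%:F)) -> forall x, P x.
Proof. by move=> Pab x; rewrite (fraction_repr x); apply/Pab/denom_ratioP. Qed.

Lemma tofrac_div_sub (R : idomainType) (a b c d : R) : b != 0 -> d != 0 ->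
  (a * d - c * b)%:F / (b * d)%:F = a%:F / b%:F - c%:F / d%:F :> {fraction R}.
Proof. by move=> b0 d0; rewrite -[- (_ / _)]mulNr addf_div ?tofrac_eq0 // tofracB !tofracM mulNr. Qed.

Section FractionMap.
Variables (R : idomainType) (f : {rmorphism R -> R}).
Hypothesis f_inj : injective f.
Local Notation F := {fraction R}.
Implicit Types (a b : R) (x y : F).

(** Has the shape of [fperm], so that the lemmas below apply to it by conversion. *)
Definition fraction_map x : F :=
  (f (\n_(generic_quotient.repr x)))%:F / (f (\d_(generic_quotient.repr x)))%:F.

Let f_eq0 a : (f a == 0) = (a == 0).
Proof. by rewrite -{1}(rmorph0 f) (inj_eq f_inj). Qed.

(** Independence of the chosen representative: [f] preserves the cross-multiplied equality, and
    injectivity keeps denominators nonzero. *)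
Lemma fraction_map_frac a b : b != 0 -> fraction_map (a%:F / b%:F) = (f a)%:F / (f b)%:F.
Proof.
move=> b0; set x := a%:F / b%:F; rewrite /fraction_map.
have := fraction_repr x; have := denom_repr_neq0 x; rewrite {2}/x.
set N := \n_ _; set D := \d_ _; rewrite tofrac_eq0 => D0.
move/eqP; rewrite eqr_div ?tofrac_eq0 // -!tofracM tofrac_eq => /eqP E.
by apply/eqP; rewrite eqr_div ?tofrac_eq0 ?f_eq0 // -!tofracM tofrac_eq -!rmorphM E.
Qed.

Lemma fraction_map_tofrac a : fraction_map a%:F = (f a)%:F.
Proof. by have := fraction_map_frac a (oner_neq0 R); rewrite !rmorph1 !divr1. Qed.

Lemma fraction_map_is_zmod_morphism : zmod_morphism fraction_map.
Proof.
elim/fractionW=> a b b0; elim/fractionW=> c d d0.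
rewrite -tofrac_div_sub // !fraction_map_frac ?mulf_neq0 //.
by rewrite (rmorphB f) !(rmorphM f) tofrac_div_sub ?f_eq0.
Qed.

Lemma fraction_map_is_monoid_morphism : monoid_morphism fraction_map.
Proof.
split; first by rewrite -{1}tofrac1 fraction_map_tofrac !rmorph1.
elim/fractionW=> a b b0; elim/fractionW=> c d d0.
rewrite mulf_div -!tofracM !fraction_map_frac ?mulf_neq0 //.
by rewrite mulf_div -!tofracM !(rmorphM f).
Qed.

End FractionMap.

Section Action.
Variables (k : fieldType) (n : nat).
Local Notation R := {mpoly k[n]}.
Local Notation F := {fraction R}.
Implicit Types (s : 'S_n) (a b : R) (x y : F).

Lemma msym_mpolyX s (i : 'I_n) : msym s ('X_i : R) = 'X_(s i).
Proof.
rewrite msymX; congr 'X_[_]; apply/mnmP => j; rewrite mnmE !mnm1E.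
by rewrite -(inj_eq (@perm_inj _ s)) permKV.
Qed.

Lemma msym_mpolyC s (c : k) : msym s (c%:MP : R) = c%:MP.
Proof. by rewrite -(mulr1 c%:MP) mul_mpolyC msymZ msym1. Qed.

Lemma msym_eq0 s a : (msym s a == 0) = (a == 0).
Proof. by rewrite -{1}(@msym0 n k s) (inj_eq (inj_msym s)). Qed.

Lemma fperm_frac s a b : b != 0 -> fperm s (a%:F / b%:F) = (msym s a)%:F / (msym s b)%:F.
Proof. exact: (fraction_map_frac (f := msym s) (inj_msym s)). Qed.

Lemma fperm_tofrac s a : fperm s a%:F = (msym s a)%:F.
Proof. exact: (fraction_map_tofrac (f := msym s) (inj_msym s)). Qed.

HB.instance Definition _ s := GRing.isZmodMorphism.Build F F (@fperm k n s)
  (fraction_map_is_zmod_morphism (f := msym s) (inj_msym s)).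
HB.instance Definition _ s := GRing.isMonoidMorphism.Build F F (@fperm k n s)
  (fraction_map_is_monoid_morphism (f := msym s) (inj_msym s)).

Lemma fpermM s1 s2 x : fperm (s1 * s2)%g x = fperm s2 (fperm s1 x).
Proof.
elim/fractionW: x => a b b0; have b0' : msym s1 b != 0 by rewrite msym_eq0.
rewrite (fperm_frac _ _ b0) (fperm_frac s1 _ b0) (fperm_frac s2 _ b0').
by rewrite (msymMm a) (msymMm b).
Qed.

Lemma fperm1 x : fperm 1 x = x.
Proof. by elim/fractionW: x => a b b0; rewrite fperm_frac // !msym1m. Qed.

Lemma xF_ord (i : 'I_n) : xF k n i = ('X_i : R)%:F.
Proof.
rewrite /xF (bigD1 i) //= big1 ?addr0 // => j /andP[/eqP/val_inj-> ].
by rewrite eqxx.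
Qed.

Lemma mpolyXU_inj : injective (fun i : 'I_n => ('X_i : R)).
Proof.
move=> i j /= /(congr1 (fun p : R => p@_(U_(i)%MM))); rewrite !mcoeffX eqxx.
by case: eqP => [/mnmP/(_ i)|_ /eqP]; rewrite ?mnm1E ?eqxx ?oner_eq0 //; case: eqP.
Qed.

Lemma fperm_xF s (i : 'I_n) : fperm s (xF k n i) = xF k n (s i).
Proof. by rewrite !xF_ord fperm_tofrac msym_mpolyX. Qed.

Lemma fperm_cF s (c : k) : fperm s (cF n c) = cF n c.
Proof. by rewrite fperm_tofrac msym_mpolyC. Qed.

Lemma xF_subr_neq0 (i j : 'I_n) : i != j -> xF k n i - xF k n j != 0.
Proof. by rewrite subr_eq0 !xF_ord tofrac_eq (inj_eq mpolyXU_inj). Qed.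

End Action.

(** * Alternants of low degree *)

(** The largest of [#|I|] distinct naturals is at least [#|I| - 1]; remove it and induct. *)
Lemma leq_sum_inj (T : finType) (f : T -> nat) (I : {set T}) :
  {in I &, injective f} -> ('C(#|I|, 2) <= \sum_(i in I) f i)%N.
Proof.
have [m] := ubnP #|I|; elim: m I => // m IHm I lt_I f_inj.
have [->|[i0 i0I]] := set_0Vmem I; first by rewrite cards0.
case: (arg_maxnP f i0I) => i iI max_i.
have {}iI : i \in I by [].
have cI : #|I| = #|I :\ i|.+1 by rewrite (cardsD1 i) iI.
have lt_f : (#|I| <= (f i).+1)%N.
  have sub : {in I, forall j, (f j < (f i).+1)%N} by move=> j jI; rewrite ltnS; apply: max_i.
  rewrite cardE -(size_map f) -(size_iota 0 (f i).+1); apply: uniq_leq_size.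
    by rewrite map_inj_in_uniq ?enum_uniq // => x y; rewrite !mem_enum; apply: f_inj.
  by move=> _ /mapP[j + ->]; rewrite mem_enum mem_iota add0n => /sub.
rewrite (big_setD1 i) //= cI binS bin1 addnC leq_add //; first by lia.
apply: IHm; first by lia.
by move=> x y /setD1P[_ xI] /setD1P[_ yI]; apply: f_inj.
Qed.

Section Alternant.
Variables (k : fieldType) (n : nat).
Local Notation R := {mpoly k[n]}.
Implicit Types (s w : 'S_n) (a b : 'I_n) (g h p z : R) (lo hi d : nat).

(* Locked: otherwise conversion unfolds the sums when it compares two alternants. *)
Definition alt : R -> R := locked (fun h => \sum_(w : 'S_n) (-1) ^+ w *: msym w h).

Lemma altE h : alt h = \sum_(w : 'S_n) (-1) ^+ w *: msym w h.
Proof. by rewrite /alt -lock. Qed.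

Lemma alt_is_linear : linear alt.
Proof.
move=> c g h; rewrite !altE scaler_sumr -big_split /=; apply: eq_bigr => w _.
by rewrite msymD msymZ scalerDr !scalerA mulrC.
Qed.
HB.instance Definition _ := GRing.isLinear.Build k R R *:%R alt alt_is_linear.

Lemma altZ c h : alt (c *: h) = c *: alt h.
Proof. exact: linearZ. Qed.

Lemma alt_sum (I : Type) (r : seq I) (Q : pred I) (E : I -> R) :
  alt (\sum_(i <- r | Q i) E i) = \sum_(i <- r | Q i) alt (E i).
Proof. exact: linear_sum. Qed.

Lemma altD g h : alt (g + h) = alt g + alt h.
Proof. exact: linearD. Qed.

Lemma altB g h : alt (g - h) = alt g - alt h.
Proof. exact: linearB. Qed.

Lemma alt_msym s h : alt (msym s h) = (-1) ^+ s *: alt h.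
Proof.
rewrite !altE [X in _ *: X](reindex_inj (mulgI s)) scaler_sumr; apply: eq_bigr => w _.
by rewrite scalerA msymMm odd_permM signr_addb signrMK.
Qed.

Lemma msym_alt s h : msym s (alt h) = (-1) ^+ s *: alt h.
Proof.
rewrite !altE raddf_sum [in RHS](reindex_inj (mulIg s)) scaler_sumr; apply: eq_bigr => w _ /=.
by rewrite msymZ scalerA msymMm odd_permM addbC signr_addb signrMK.
Qed.

Hypothesis char2 : 2%:R != 0 :> k.

(** The transposition changes the sign of the alternant, so [alt h = - alt h]. *)
Lemma alt_fixed0 a b h : a != b -> msym (tperm a b) h = h -> alt h = 0.
Proof.
move=> ab fix_h; have := alt_msym (tperm a b) h; rewrite fix_h odd_tperm ab expr1 scaleN1r.
move/eqP; rewrite -subr_eq0 opprK -mulr2n -scaler_nat scaler_eq0 (negPf char2) /=.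
by move/eqP.
Qed.

Definition rdeg lo hi (m : 'X_{1..n}) : nat := \sum_(i < n | (lo <= i < hi)%N) m i.
(** A bound on every monomial: the zero polynomial satisfies all bounds, and cancellation in sums is
    harmless. *)
Definition rdeg_le lo hi d p := forall m, m \in msupp p -> (rdeg lo hi m <= d)%N.
Definition sym_on lo hi z := forall a b, (lo <= a < hi)%N -> (lo <= b < hi)%N ->
  msym (tperm a b) z = z.

Lemma rdeg_le_trans lo hi d d' p : (d <= d')%N -> rdeg_le lo hi d p -> rdeg_le lo hi d' p.
Proof. by move=> le_d dp m /dp /leq_trans; apply. Qed.

Lemma rdeg_leM lo hi d1 d2 p1 p2 :
  rdeg_le lo hi d1 p1 -> rdeg_le lo hi d2 p2 -> rdeg_le lo hi (d1 + d2) (p1 * p2).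
Proof.
move=> dp1 dp2 m /msuppM_le/allpairsP[[m1 m2] /= [/dp1 le1 /dp2 le2 ->]].
rewrite /rdeg; under eq_bigr do rewrite mnmDE.
by rewrite big_split leq_add.
Qed.

Lemma rdeg_leB lo hi d p1 p2 :
  rdeg_le lo hi d p1 -> rdeg_le lo hi d p2 -> rdeg_le lo hi d (p1 - p2).
Proof. by move=> dp1 dp2 m /msuppB_le; rewrite mem_cat => /orP[/dp1|/dp2]. Qed.

Lemma rdeg_leZ lo hi d c p : rdeg_le lo hi d p -> rdeg_le lo hi d (c *: p).
Proof. by move=> dp m /msuppZ_le/dp. Qed.

Lemma rdeg_le1 lo hi d : rdeg_le lo hi d 1.
Proof.
by move=> m; rewrite msupp1 inE => /eqP->; rewrite /rdeg big1 // => i _; rewrite mnm0E.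
Qed.

Lemma rdeg_le_mpolyX lo hi i : rdeg_le lo hi 1 'X_i.
Proof.
move=> m; rewrite msuppX inE => /eqP->; rewrite /rdeg big_mkcond (bigD1 i) //= big1.
  by rewrite mnm1E eqxx; case: ifP.
by move=> j ji; rewrite mnm1E eq_sym (negPf ji); case: ifP.
Qed.

Lemma rdeg_le_sum lo hi d (I : Type) (r : seq I) (P : pred I) (E : I -> R) :
  (forall i, P i -> rdeg_le lo hi d (E i)) -> rdeg_le lo hi d (\sum_(i <- r | P i) E i).
Proof.
move=> dE; elim/big_ind: _ => //; first by move=> m; rewrite msupp0.
by move=> x y dx dy m /msuppD_le; rewrite mem_cat => /orP[/dx|/dy].
Qed.

Lemma rdeg_le_prod lo hi (I : eqType) (r : seq I) (P : pred I) (D : I -> nat) (E : I -> R) :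
  (forall i, i \in r -> P i -> rdeg_le lo hi (D i) (E i)) ->
  rdeg_le lo hi (\sum_(i <- r | P i) D i) (\prod_(i <- r | P i) E i).
Proof.
move=> dE; rewrite big_seq_cond [X in rdeg_le _ _ _ X]big_seq_cond.
elim/big_rec2: _ => [|i y1 y2 /andP[ir Pi]]; first exact: rdeg_le1.
by apply: rdeg_leM; apply: dE.
Qed.

Lemma rdeg_leX lo hi d p e : rdeg_le lo hi d p -> rdeg_le lo hi (e * d) (p ^+ e).
Proof.
move=> dp; elim: e => [|e IHe]; first exact: rdeg_le1.
by rewrite exprS mulSn; apply: rdeg_leM.
Qed.

Lemma sym_on1 lo hi : sym_on lo hi 1.
Proof. by move=> a b _ _; rewrite msym1. Qed.

Lemma sym_onM lo hi z1 z2 : sym_on lo hi z1 -> sym_on lo hi z2 -> sym_on lo hi (z1 * z2).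
Proof. by move=> h1 h2 a b la lb; rewrite msymM h1 // h2. Qed.

Lemma sym_onB lo hi z1 z2 : sym_on lo hi z1 -> sym_on lo hi z2 -> sym_on lo hi (z1 - z2).
Proof. by move=> h1 h2 a b la lb; rewrite msymB h1 // h2. Qed.

Lemma sym_onZ lo hi c z : sym_on lo hi z -> sym_on lo hi (c *: z).
Proof. by move=> h a b la lb; rewrite msymZ h. Qed.

Lemma sym_onX lo hi z e : sym_on lo hi z -> sym_on lo hi (z ^+ e).
Proof.
by move=> h; elim: e => [|e IHe]; [exact: sym_on1|rewrite exprS; apply: sym_onM].
Qed.

Lemma sym_on_prod lo hi (I : eqType) (r : seq I) (P : pred I) (E : I -> R) :
  (forall i, i \in r -> P i -> sym_on lo hi (E i)) -> sym_on lo hi (\prod_(i <- r | P i) E i).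
Proof.
move=> sE; rewrite big_seq_cond; apply: big_ind => [||i /andP[]]; last exact: sE.
  exact: sym_on1.
exact: sym_onM.
Qed.

Lemma sym_on_sub lo hi lo' hi' z : (lo <= lo')%N -> (hi' <= hi)%N ->
  sym_on lo hi z -> sym_on lo' hi' z.
Proof. by move=> ? ? h a b ? ?; apply: h; lia. Qed.

(* By pigeonhole each monomial of [p] has two equal exponents in the range. *)
Lemma alt_lowdeg lo hi d p z : (hi <= n)%N -> rdeg_le lo hi d p -> (d < 'C(hi - lo, 2))%N ->
  sym_on lo hi z -> alt (p * z) = 0.
Proof.
move=> le_hn dp lt_d sz; rewrite {1}(mpolyE p) mulr_suml raddf_sum /= big_seq big1 // => m mp.
rewrite -scalerAl linearZ /=; pose I := [set i : 'I_n | (lo <= i < hi)%N].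
have cI : #|I| = (hi - lo)%N.
  rewrite -sum1_card (eq_bigl (fun i : 'I_n => (lo <= i < hi)%N)); last by move=> i; rewrite inE.
  transitivity (\sum_(lo <= i < hi) 1)%N; last by rewrite sum_nat_const_nat muln1.
  rewrite (big_nat_widen _ _ _ _ _ le_hn) big_geq_mkord; apply: eq_bigl => i /=.
  by rewrite andbC.
have [/forallP inj|] := boolP [forall a, forall b, [==> a \in I, b \in I, m a == m b => a == b]].
  suff /leq_sum_inj le_m : {in I &, injective m}.
    have E : rdeg lo hi m = (\sum_(i in I) m i)%N by apply: eq_bigl => i; rewrite inE.
    by move: le_m; rewrite -E => /leq_trans/(_ (dp m mp)); rewrite cI leqNgt lt_d.
  move=> a b aI bI eq_m; have /forallP/(_ b) := inj a.
  by rewrite aI bI eq_m eqxx => /eqP.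
rewrite negb_forall => /existsP[a]; rewrite negb_forall => /existsP[b].
rewrite !negb_imply => /and4P[aI bI /eqP eq_m ne_ab]; rewrite !inE in aI bI.
rewrite (@alt_fixed0 a b) ?scaler0 // msymM sz // msymX; congr ('X_[_] * _).
by apply/mnmP => i; rewrite mnmE tpermV; case: tpermP => [->|->|].
Qed.

End Alternant.

(** * Vanishing relations *)

Section QAlternants.
Variables (k : fieldType) (q : k) (n : nat).
Local Notation R := {mpoly k[n]}.
Implicit Types (s w : 'S_n) (a b : 'I_n) (h p z t : R) (lo hi d i j m : nat).

(* 0-based: [xp i] is the paper's x_(i+1), whereas [yp j] is its y_j = x_1 + ... + x_j. *)
Definition xp i : R := \sum_(l < n | val l == i) 'X_l.
Definition yp j : R := \sum_(l < n | (l < j)%N) 'X_l.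
Definition qfac i j : R := xp j - q *: xp i.
Definition qrow i j : R := \prod_(0 <= a < i) qfac a j.
(* The pairs of adjacent variables are missing: their factors cancel against the denominator in the
   definition of [qDS]. *)
Definition qnonadj m : R := \prod_(0 <= b < m) qrow b.-1 b.

Lemma xp_ord a : xp a = 'X_a.
Proof.
rewrite /xp (bigD1 a) //= big1 ?addr0 // => j /andP[/eqP/val_inj-> ].
by rewrite eqxx.
Qed.

Lemma ypS j : yp j.+1 = yp j + xp j.
Proof.
rewrite /yp /xp (bigID (fun l : 'I_n => (l < j)%N)) /=.
by congr (_ + _); apply: eq_bigl => l; lia.
Qed.

Lemma yp0 : yp 0 = 0.
Proof. by rewrite /yp big_pred0. Qed.

Lemma ypE j : yp j = \sum_(l < j) xp l.
Proof.
by elim: j => [|j IHj]; rewrite ?yp0 ?big_ord0 // ypS big_ord_recr IHj.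
Qed.

Lemma tperm_range (a b c : 'I_n) lo hi :
  (lo <= a < hi)%N -> (lo <= b < hi)%N -> (lo <= tperm a b c < hi)%N = (lo <= c < hi)%N.
Proof. by case: tpermP => [->|->|] // -> ->. Qed.

Lemma tperm_lt (a b c : 'I_n) j : (a < j)%N = (b < j)%N -> (tperm a b c < j)%N = (c < j)%N.
Proof. by case: tpermP => [->|->|]. Qed.

Lemma sym_on_yp lo hi j : (j <= lo)%N || (hi <= j)%N -> sym_on lo hi (yp j).
Proof.
move=> out a b la lb; have eq_ab : (a < j)%N = (b < j)%N by lia.
rewrite /yp raddf_sum [RHS](reindex_inj (@perm_inj _ (tperm a b))) /=.
by apply: eq_big => c; rewrite ?msym_mpolyX // tperm_lt.
Qed.

Lemma sym_on_xp lo hi j : (j < lo)%N || (hi <= j)%N -> sym_on lo hi (xp j).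
Proof.
by move=> out; rewrite -[xp j](addKr (yp j)) -ypS addrC; apply: sym_onB; apply: sym_on_yp; lia.
Qed.

Lemma rdeg_le_xp lo hi i : rdeg_le lo hi 1 (xp i).
Proof. by apply: rdeg_le_sum => l _; apply: rdeg_le_mpolyX. Qed.

Lemma rdeg_le_yp lo hi i : rdeg_le lo hi 1 (yp i).
Proof. by apply: rdeg_le_sum => l _; apply: rdeg_le_mpolyX. Qed.

Lemma rdeg_le_qfac lo hi i j : rdeg_le lo hi 1 (qfac i j).
Proof. by apply: rdeg_leB; [|apply: rdeg_leZ]; apply: rdeg_le_xp. Qed.

Lemma sym_on_qfac lo hi i j : (i < lo)%N || (hi <= i)%N -> (j < lo)%N || (hi <= j)%N ->
  sym_on lo hi (qfac i j).
Proof. by move=> oi oj; apply: sym_onB; [|apply: sym_onZ]; apply: sym_on_xp. Qed.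

Lemma rdeg_le_prod1 lo hi i j (E : nat -> R) :
  (forall l, (i <= l < j)%N -> rdeg_le lo hi 1 (E l)) ->
  rdeg_le lo hi (j - i) (\prod_(i <= l < j) E l).
Proof.
move=> dE; have -> : (j - i = \sum_(i <= l < j) 1)%N by rewrite sum_nat_const_nat muln1.
by apply: rdeg_le_prod => l; rewrite mem_index_iota => /dE.
Qed.

(** Counts the pairs [(a, b)] with [i <= a] and [a + 1 < b < m]. *)
Lemma sum_pred_bin2 i m : (i <= m)%N -> (\sum_(i.+1 <= b < m) (b.-1 - i) = 'C((m - i).-1, 2))%N.
Proof.
move=> /subnKC <-; elim: (m - i)%N => [|d IHd]; first by rewrite addn0 subnn big_geq // leqnSn.
case: d IHd => [|d] IHd; first by rewrite addn1 big_geq // subSnn.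
rewrite addnS big_nat_recr /=; last by lia.
rewrite IHd !addKn addnS /= addKn.
have -> : ((i + d).+2 - i = d.+2)%N by lia.
by rewrite /= binS bin1 addnC.
Qed.

Lemma rdeg_le_qrows lo hi i m : (i <= m)%N ->
  rdeg_le lo hi 'C((m - i).-1, 2) (\prod_(i.+1 <= b < m) \prod_(i <= a < b.-1) qfac a b).
Proof.
move=> le_im; rewrite -sum_pred_bin2 //; apply: rdeg_le_prod => b _ _.
by apply: rdeg_le_prod1 => a _; apply: rdeg_le_qfac.
Qed.

Lemma qnonadjE m : (0 < m)%N ->
  qnonadj m = \prod_(1 <= b < m) \prod_(0 <= a < b.-1) qfac a b.
Proof. by move=> m0; rewrite /qnonadj big_ltn // /qrow big_geq // mul1r. Qed.

(** The bound falls short of ['C(m, 2)] by [m.-1]: a cofactor of degree less than [m.-1] is still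
    killed by [alt_lowdeg]. *)
Lemma rdeg_le_qnonadj lo hi m : rdeg_le lo hi 'C(m.-1, 2) (qnonadj m).
Proof.
case: m => [|m]; first by rewrite /qnonadj big_geq //; apply: rdeg_le1.
by rewrite qnonadjE //; have := @rdeg_le_qrows lo hi 0 m.+1 isT; rewrite subn0.
Qed.

Lemma qnonadjS m : qnonadj m.+1 = qnonadj m * qrow m.-1 m.
Proof. by rewrite /qnonadj big_nat_recr. Qed.

Lemma qrowS i j : qrow i.+1 j = qrow i j * qfac i j.
Proof. by rewrite /qrow big_nat_recr. Qed.

(** The only adjacent pair separated by [i] is [(i.-1, i)]. Its factor completes the product over
    all separated pairs and leaves the non-adjacent pairs of each block. *)
Lemma qnonadj_split i m : (0 < i < m)%N ->
  qfac i.-1 i * qnonadj m =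
  qnonadj i * (\prod_(i.+1 <= b < m) \prod_(i <= a < b.-1) qfac a b) *
  (\prod_(i <= b < m) qrow i b).
Proof.
case/andP=> i0 ltim; rewrite {1}/qnonadj (big_cat_nat (n := i)) //=; last exact: ltnW.
rewrite -/(qnonadj i) mulrCA -mulrA; congr (_ * _).
have -> : \prod_(i <= b < m) qrow i b = qrow i i * \prod_(i.+1 <= b < m) qrow i b.
  by rewrite big_ltn.
have -> : qrow i i = qrow i.-1 i * qfac i.-1 i by rewrite -qrowS prednK.
rewrite big_ltn // mulrCA [RHS]mulrCA -[RHS]mulrA; congr (_ * (_ * _)).
rewrite -big_split /= !big_nat; apply: eq_bigr => b /andP[ib _].
rewrite /qrow (big_cat_nat (n := i)) //=; last by lia.
by rewrite mulrC.
Qed.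

(** Stated for any ring morphism, to cover both [msym] and its extension to polynomials in
    [sym_on_esign]. *)
Lemma prod_range_fixed (A : comPzRingType) (phi : {rmorphism A -> A}) s lo hi (E : nat -> A) :
  (hi <= n)%N -> (forall c : 'I_n, (lo <= s c < hi)%N = (lo <= c < hi)%N) ->
  (forall c : 'I_n, (lo <= c < hi)%N -> phi (E c) = E (s c)) ->
  phi (\prod_(lo <= l < hi) E l) = \prod_(lo <= l < hi) E l.
Proof.
move=> le_hn s_range phiE.
have -> : \prod_(lo <= l < hi) E l = \prod_(l < n | (lo <= l < hi)%N) E l.
  by rewrite (big_nat_widen _ _ _ _ _ le_hn) big_geq_mkord; apply: eq_bigl => l; rewrite andbC.
rewrite rmorph_prod [RHS](reindex_inj (@perm_inj _ s)) /=.
by apply: eq_big => [c|c lc]; [rewrite s_range|apply: phiE].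
Qed.

Lemma msym_xp s c : msym s (xp (val c)) = xp (s c).
Proof. by rewrite !xp_ord msym_mpolyX. Qed.

Lemma sym_on_qrow i j : (i <= n)%N -> (i <= j)%N -> sym_on 0 i (qrow i j).
Proof.
move=> le_in le_ij a b la lb; apply: (prod_range_fixed (s := tperm a b)) => // c.
  exact: tperm_range.
move=> lc; by rewrite /qfac [LHS]msymB msymZ msym_xp (@sym_on_xp 0 i) ?le_ij ?orbT.
Qed.

Lemma sym_on_qrows_col i m : (m <= n)%N -> sym_on i m (\prod_(i <= b < m) qrow i b).
Proof.
move=> le_mn a b la lb; apply: (prod_range_fixed (s := tperm a b)) => // c.
  exact: tperm_range.
move=> lc; rewrite /qrow [LHS]rmorph_prod /= !big_nat; apply: eq_bigr => l ll.
have l_out : (l < i)%N || (m <= l)%N by lia.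
by rewrite /qfac [LHS]msymB msymZ msym_xp (sym_on_xp l_out).
Qed.

Hypothesis char2 : 2%:R != 0 :> k.

(** [yp m] is symmetric in the first [m] variables, so it does not count in the degree. *)
Lemma alt_yp_top m d p t : (0 < m <= n)%N -> rdeg_le 0 m d p -> (d < m.-1)%N ->
  sym_on 0 m t -> alt (t * yp m * p * qnonadj m) = 0.
Proof.
case/andP=> m0 le_mn dp ltd st; rewrite -mulrA mulrC.
apply: (alt_lowdeg char2 le_mn (rdeg_leM dp (@rdeg_le_qnonadj 0 m m))).
  by rewrite subn0 -{2}(prednK m0) binS bin1; lia.
by apply: sym_onM => //; apply: sym_on_yp; rewrite leqnn orbT.
Qed.

(** * Vanishing after splitting the variables into two blocks *)

Section Vanishing.
Variables (i m : nat) (t : R).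
Hypotheses (i_range : (0 < i < m)%N) (le_mn : (m <= n)%N) (st : sym_on 0 m t).

(* Either [f] has too small a degree in the variables below [i], or [g] in those from [i] on. *)
Lemma alt_split_vanish c d1 d2 f g : (0 < c)%N -> (c + d1 + d2 <= m.-2)%N ->
  rdeg_le 0 i d1 f -> sym_on i m f -> rdeg_le i m d2 g -> sym_on 0 i g ->
  alt (t * yp i ^+ c * f * g * (qfac i.-1 i * qnonadj m)) = 0.
Proof.
move=> c0 le_d df sf dg sg; case/andP: i_range => i0 ltim; rewrite qnonadj_split //.
set PJ := \prod_(i.+1 <= b < m) _; set C := \prod_(_ <= _ < _) _.
have dPI := @rdeg_le_qnonadj 0 i i.
have dPJ : rdeg_le i m 'C((m - i).-1, 2) PJ by apply: rdeg_le_qrows; lia.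
have sPI : sym_on i m (qnonadj i).
  apply: sym_on_prod => b; rewrite mem_index_iota => lb _.
  apply: sym_on_prod => a; rewrite mem_index_iota => la _; apply: sym_on_qfac; lia.
have sPJ : sym_on 0 i PJ.
  apply: sym_on_prod => b; rewrite mem_index_iota => lb _.
  apply: sym_on_prod => a; rewrite mem_index_iota => la _; apply: sym_on_qfac; lia.
have sC1 : sym_on 0 i C.
  by apply: sym_on_prod => b; rewrite mem_index_iota => lb _; apply: sym_on_qrow; lia.
have sC2 : sym_on i m C by apply: sym_on_qrows_col.
(* As [c > 0], [d1 + d2 < (i - 1) + (m - i - 1)], so [d1 < i - 1] or [d2 < m - i - 1]; [yp i] is
   symmetric in both blocks. *)
have [lt_d1|ge_d1] := ltnP d1 i.-1.
  have -> : t * yp i ^+ c * f * g * (qnonadj i * PJ * C) =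
            f * qnonadj i * (t * yp i ^+ c * g * PJ * C) by ring.
  apply: (alt_lowdeg char2 _ (rdeg_leM df dPI)); first by lia.
    by rewrite subn0 -{2}(prednK i0) binS bin1; lia.
  have st' : sym_on 0 i t by apply: sym_on_sub st; lia.
  by do !apply: sym_onM => //; apply: sym_onX; apply: sym_on_yp; rewrite leqnn orbT.
have -> : t * yp i ^+ c * f * g * (qnonadj i * PJ * C) =
          g * PJ * (t * yp i ^+ c * f * qnonadj i * C) by ring.
apply: (alt_lowdeg char2 le_mn (rdeg_leM dg dPJ)).
  by rewrite -{2}[(m - i)%N]prednK ?subn_gt0 // binS bin1; lia.
have st' : sym_on i m t by apply: sym_on_sub st; lia.
by do !apply: sym_onM => //; apply: sym_onX; apply: sym_on_yp; rewrite leqnn.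
Qed.

(* Stable under multiplication by any [yp j], since [yp j - yp i] only involves variables from [i] on. *)
Definition absorbed d p := forall c d1 d2 f g, (0 < c)%N -> (c + d1 + d2 + d <= m.-2)%N ->
  rdeg_le 0 i d1 f -> sym_on i m f -> rdeg_le i m d2 g -> sym_on 0 i g ->
  alt (t * yp i ^+ c * f * g * p * (qfac i.-1 i * qnonadj m)) = 0.

Lemma absorbed1 : absorbed 0 1.
Proof.
move=> c d1 d2 f g c0 le_d df sf dg sg; rewrite mulr1.
by apply: (alt_split_vanish c0 _ df sf dg sg); lia.
Qed.

(** For [j <= i] the factor joins [f]. Otherwise [yp j = yp i + (yp j - yp i)]: the first term joins
    [f] and the second joins [g]. *)
Lemma absorbedM_yp d p j : (j <= m)%N -> absorbed d p -> absorbed d.+1 (p * yp j).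
Proof.
move=> le_jm abs_p c d1 d2 f g c0 le_d df sf dg sg; have [le_ji|lt_ij] := leqP j i.
  have -> : t * yp i ^+ c * f * g * (p * yp j) * (qfac i.-1 i * qnonadj m) =
    t * yp i ^+ c * (f * yp j) * g * p * (qfac i.-1 i * qnonadj m) by ring.
  apply: (abs_p c d1.+1 d2) => //; first by lia.
    by rewrite -addn1; apply: rdeg_leM => //; apply: rdeg_le_yp.
  by apply: sym_onM => //; apply: sym_on_yp; rewrite le_ji.
have -> : t * yp i ^+ c * f * g * (p * yp j) * (qfac i.-1 i * qnonadj m) =
  t * yp i ^+ c * (f * yp i) * g * p * (qfac i.-1 i * qnonadj m) +
  t * yp i ^+ c * f * (g * (yp j - yp i)) * p * (qfac i.-1 i * qnonadj m) by ring.
rewrite linearD /= (abs_p c d1.+1 d2) ?(abs_p c d1 d2.+1) ?addr0 //; try by lia.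
- by rewrite -addn1; apply: rdeg_leM => //; apply: rdeg_leB; apply: rdeg_le_yp.
- by apply: sym_onM => //; apply: sym_onB; apply: sym_on_yp; lia.
- by rewrite -addn1; apply: rdeg_leM => //; apply: rdeg_le_yp.
by apply: sym_onM => //; apply: sym_on_yp; rewrite leqnn.
Qed.

Lemma absorbedMX_yp d p j e : (j <= m)%N -> absorbed d p -> absorbed (d + e) (p * yp j ^+ e).
Proof.
move=> le_jm abs_p; elim: e => [|e IHe]; first by rewrite addn0 mulr1.
by rewrite exprSr mulrA addnS; apply: absorbedM_yp.
Qed.

Lemma absorbed_prod (r : seq nat) (P : pred nat) (c : nat -> nat) :
  (forall j, j \in r -> P j -> (j <= m)%N) ->
  absorbed (\sum_(j <- r | P j) c j) (\prod_(j <- r | P j) yp j ^+ c j).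
Proof.
elim: r => [|j r IHr] le_r; first by rewrite !big_nil; apply: absorbed1.
rewrite !big_cons; have {}IHr := IHr (fun l lr => le_r l (mem_behead (s := j :: r) lr)).
have := le_r j (mem_head _ _); case: (P j) => // /(_ isT) le_jm.
by rewrite addnC mulrC; apply: absorbedMX_yp.
Qed.

Lemma alt_yp_vanish d p : absorbed d p -> (d < m.-2)%N ->
  alt (t * yp i * p * (qfac i.-1 i * qnonadj m)) = 0.
Proof.
move=> abs_p lt_d; have := abs_p 1%N 0%N 0%N 1 1 isT.
rewrite !mulr1; apply=> //; try exact: rdeg_le1; exact: sym_on1.
Qed.

End Vanishing.
End QAlternants.

(** * Evaluation at the all-ones composition *)

Section ElementarySymmetric.
Variables (k : fieldType) (q : k) (n : nat).
Local Notation R := {mpoly k[n]}.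
Implicit Types (a b : 'I_n) (h p z t : R) (lo hi d e i j m : nat).
Local Notation xp := (xp k n).
Local Notation yp := (yp k n).
Local Notation qrow := (@qrow k q n).
Local Notation qnonadj := (qnonadj q n).

(* Up to sign, the elementary symmetric polynomial of degree [e] in the first [m] variables. *)
Definition esign m e : R := (\prod_(0 <= a < m) (1 - xp a *: 'X))`_e.

Lemma esignS m e : esign m.+1 e.+1 = esign m e.+1 - xp m * esign m e.
Proof. by rewrite /esign big_nat_recr //= mulrBr mulr1 coefB -scalerAr coefZ coefMX. Qed.

Lemma esign0 m : esign m 0 = 1.
Proof.
rewrite /esign; elim: m => [|m IHm]; first by rewrite big_geq // coef1.
by rewrite big_nat_recr //= mulrBr mulr1 coefB -scalerAr coefZ coefMX IHm mulr0 subr0.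
Qed.

Lemma esign_big m e : (m < e)%N -> esign m e = 0.
Proof.
elim: m e => [|m IHm] [|e] // lt_e; first by rewrite /esign big_geq // coef1.
by rewrite esignS !IHm ?mulr0 ?subr0 //; lia.
Qed.

Lemma sym_on_esign m e : (m <= n)%N -> sym_on 0 m (esign m e).
Proof.
move=> le_mn a b la lb; rewrite /esign -[LHS](coef_map (msym (tperm a b))); congr ((polyseq _)`_e).
apply: (prod_range_fixed (phi := map_poly (msym (tperm a b))) (s := tperm a b)) => // c.
  exact: tperm_range.
by move=> lc; rewrite rmorphB rmorph1 /= map_polyZ map_polyX /= msym_xp.
Qed.

(** Vieta's formula for the monic polynomial with roots [q *: xp a], evaluated at [xp j]. *)
Lemma qrow_esign m j :
  qrow m j = \sum_(e < m.+1) q ^+ e *: (esign m e * xp j ^+ (m - e)).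
Proof.
elim: m => [|m IHm].
  by rewrite /qrow big_geq // big_ord1 expr0 scale1r esign0 mul1r.
rewrite qrowS IHm /qfac; set z := xp j.
rewrite [in RHS]big_ord_recl expr0 scale1r esign0 mul1r subn0.
rewrite [X in _ = _ + X](eq_bigr (fun e : 'I_m.+1 => q ^+ e.+1 *: (esign m e.+1 * z ^+ (m - e))
    - q ^+ e.+1 *: (xp m * esign m e * z ^+ (m - e)))); last first.
  by move=> e _; rewrite lift0 esignS subSS mulrBl scalerBr.
rewrite sumrB addrA.
have -> : z ^+ m.+1 + \sum_(e < m.+1) q ^+ e.+1 *: (esign m e.+1 * z ^+ (m - e)) =
    \sum_(e < m.+1) q ^+ e *: (esign m e * z ^+ (m.+1 - e)).
  transitivity (\sum_(e < m.+2) q ^+ e *: (esign m e * z ^+ (m.+1 - e))).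
    by rewrite [RHS]big_ord_recl expr0 scale1r esign0 mul1r subn0.
  by rewrite big_ord_recr /= esign_big // mul0r scaler0 addr0.
rewrite mulrBr !mulr_suml; congr (_ - _); apply: eq_bigr => -[e le_e] _ /=.
  by rewrite -scalerAl -mulrA -exprSr subSn.
by rewrite -!mul_mpolyC exprS mpolyCM; ring.
Qed.

Hypothesis char2 : 2%:R != 0 :> k.

(* All the terms of [qrow_esign] give the same alternant up to their power of [q]. *)
Lemma alt_qrow m h t : (m < n)%N -> rdeg_le 0 m.+1 'C(m, 2) h -> sym_on 0 m.+1 t ->
  alt (t * h * qrow m m) = qint q m.+1 *: alt (t * h * xp m ^+ m).
Proof.
move=> lt_mn dh st; have [b bE] : exists b : nat -> R, forall e, b e = alt (t * h * (esign m e * xp m ^+ (m - e))).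
  by exists (fun e => alt (t * h * (esign m e * xp m ^+ (m - e)))).
(* By [esignS] the difference contains [esign m.+1 e.+1], symmetric in [m.+1] variables; the rest
   has degree at most ['C(m, 2) + (m - e.+1)], less than ['C(m.+1, 2)]. *)
have b_step e : (e < m)%N -> b e.+1 = b e.
  move=> lt_e; apply/eqP; rewrite !bE -subr_eq0 -altB; apply/eqP.
  have -> : (m - e = (m - e.+1).+1)%N by lia.
  have -> : t * h * (esign m e.+1 * xp m ^+ (m - e.+1))
      - t * h * (esign m e * xp m ^+ (m - e.+1).+1)
      = (h * xp m ^+ (m - e.+1)) * (t * esign m.+1 e.+1) by rewrite esignS exprS; ring.
  have dx : rdeg_le 0 m.+1 ((m - e.+1) * 1) (xp m ^+ (m - e.+1)).
    by apply: rdeg_leX; apply: rdeg_le_xp.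
  apply: (alt_lowdeg char2 lt_mn (rdeg_leM dh dx)).
    by rewrite subn0 binS bin1; lia.
  by apply: sym_onM => //; apply: sym_on_esign.
have b_const e : (e <= m)%N -> b e = b 0%N.
  elim: e => [|e IHe] lt_e; first by [].
  rewrite (b_step _ lt_e); exact: IHe (ltnW lt_e).
rewrite qrow_esign.
rewrite mulr_sumr.
rewrite alt_sum.
rewrite /qint scaler_suml.
apply: eq_bigr => -[e le_e] _.
rewrite -scalerAr.
rewrite altZ.
have := b_const e le_e; rewrite !bE esign0 mul1r subn0 => E0.
by congr (_ *: _).
Qed.

(* Keeps every alternant in all [n] variables while [m] of them are treated by induction. *)
Definition tail m : R := \prod_(m <= l < n) xp l ^+ l.

Lemma tail_recl m : (m < n)%N -> tail m = xp m ^+ m * tail m.+1.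
Proof. by move=> lt_m; rewrite /tail big_ltn. Qed.

Lemma sym_on_tail m : sym_on 0 m (tail m).
Proof.
apply: sym_on_prod => l; rewrite mem_index_iota => /andP[le_ml _] _.
by apply: sym_onX; apply: sym_on_xp; rewrite le_ml orbT.
Qed.

Lemma alt_tail_qrow m h : (m < n)%N -> rdeg_le 0 m.+1 'C(m, 2) h ->
  alt (tail m.+1 * h * qrow m m) = qint q m.+1 *: alt (tail m * h).
Proof.
move=> lt_mn dh; rewrite (tail_recl lt_mn) (alt_qrow lt_mn dh (@sym_on_tail _)).
by congr (_ *: alt _); rewrite mulrC mulrA.
Qed.

(** Rows are removed one at a time, row [b] giving the factor [qint q b.+1]. The case [m = n]
    evaluates [symmetrizer 1]. *)
Lemma alt_qprod m : (m <= n)%N ->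
  alt (tail m * \prod_(0 <= b < m) qrow b b) = qfact q m *: alt (tail 0).
Proof.
elim: m => [|m IHm] lt_m; first by rewrite big_geq // mulr1 /qfact big_ord0 scale1r.
rewrite big_nat_recr //= mulrA alt_tail_qrow //.
  rewrite (IHm (ltnW lt_m)) scalerA; congr (_ *: _).
  by rewrite /qfact [RHS]big_ord_recr mulrC.
have <- : (\sum_(0 <= b < m) b = 'C(m, 2))%N by rewrite bin2_sum.
apply: rdeg_le_prod => b _ _; have := @rdeg_le_prod1 k n 0 m.+1 0 b.
by rewrite subn0; apply=> l _; apply: rdeg_le_qfac.
Qed.

Definition yprod m : R := \prod_(1 <= j < m) yp j.

Lemma rdeg_le_yprod lo hi m : rdeg_le lo hi m.-1 (yprod m).
Proof. by rewrite -subn1; apply: rdeg_le_prod1 => l _; apply: rdeg_le_yp. Qed.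

Lemma yprod_bigD1 m i : (0 < i < m)%N ->
  yprod m = yp i * \prod_(1 <= j < m | j != i) yp j ^+ 1.
Proof. by move=> li; rewrite /yprod (bigD1_seq i) ?mem_index_iota ?iota_uniq. Qed.

(** The difference of the two sides carries [qfac i.-1 i], and [yprod m] contains [yp i], so
    [alt_yp_vanish] applies. *)
Lemma alt_yprod_step m i : (0 < i < m)%N -> (m < n)%N ->
  alt (tail m.+1 * yprod m * xp i * qnonadj m.+1) =
  q *: alt (tail m.+1 * yprod m * xp i.-1 * qnonadj m.+1).
Proof.
move=> li lt_mn; apply/eqP; rewrite -subr_eq0 -altZ -altB; apply/eqP.
have li' : (0 < i < m.+1)%N by lia.
have le_r j : j \in index_iota 1 m -> j != i -> (j <= m.+1)%N.
  by rewrite mem_index_iota; lia.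
have abs := @absorbed_prod k q n char2 i m.+1 (tail m.+1) li' lt_mn (@sym_on_tail _)
  (index_iota 1 m) (fun j => j != i) (fun _ => 1%N) le_r.
have := alt_yp_vanish abs.
set d := (\sum_(_ <- _ | _) _)%N.
have Ed : (d.+1 = m.-1)%N.
  transitivity (\sum_(1 <= j < m) 1)%N; last by rewrite sum_nat_const_nat muln1 subn1.
  by rewrite (bigD1_seq i) ?mem_index_iota ?iota_uniq.
move=> /(_ ltac:(rewrite /=; lia)) <-.
congr alt; rewrite (yprod_bigD1 li) /qfac -!mul_mpolyC; ring.
Qed.

(** Here [yprod m] lacks [yp m] and the difference survives: [qfac m.-1 m] completes the last row of
    [qnonadj m.+1], which [alt_tail_qrow] evaluates. *)
Lemma alt_yprod_last m : (0 < m < n)%N ->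
  alt (tail m.+1 * yprod m * xp m * qnonadj m.+1) =
  q *: alt (tail m.+1 * yprod m * xp m.-1 * qnonadj m.+1)
  + qint q m.+1 *: alt (tail m * (yprod m * qnonadj m)).
Proof.
case/andP=> m0 lt_mn; have dh : rdeg_le 0 m.+1 'C(m, 2) (yprod m * qnonadj m).
  apply: (rdeg_le_trans (d := (m.-1 + 'C(m.-1, 2))%N)).
    by rewrite -{3}(prednK m0) binS bin1 addnC.
  by apply: rdeg_leM; [apply: rdeg_le_yprod|apply: rdeg_le_qnonadj].
rewrite -(alt_tail_qrow lt_mn dh) -altZ -altD; congr alt.
have -> : qrow m m = qrow m.-1 m * @qfac k q n m.-1 m by rewrite -qrowS (prednK m0).
rewrite qnonadjS /qfac -!mul_mpolyC; ring.
Qed.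

(** Let [a] be the value for [m], and [E j] the alternant for [m.+1] with [yp m] replaced by [xp j].
    Then [E j = q^j E 0] for [j < m] and [E m = q^m E 0 + [m+1] a]. All the [E j] add up to 0
    because [yp m.+1] is symmetric, so [E 0 = - a]. The value for [m.+1] is the sum over [j < m],
    that is [- [m] a]. *)
Lemma alt_yprod m : (forall l, (0 < l <= n)%N -> qint q l != 0) -> (0 < m <= n)%N ->
  alt (tail m * (yprod m * qnonadj m)) = ((-1) ^+ m.-1 * qfact q m.-1) *: alt (tail 0).
Proof.
move=> qint0; elim: m => // m IHm /= lt_m; have [m0|m0] := posnP m.
  subst m; rewrite /yprod big_geq // qnonadjE // big_geq // !mulr1 /qfact big_ord0 mulr1 scale1r.
  by rewrite [tail 0]tail_recl // mul1r.
pose E j := alt (tail m.+1 * yprod m * xp j * qnonadj m.+1).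
have Egeom j : (j < m)%N -> E j = q ^+ j *: E 0%N.
  elim: j => [|j IHj] lt_j; first by rewrite scale1r.
  by rewrite /E alt_yprod_step //= -/(E j) IHj 1?ltnW // scalerA exprS.
have Elast : E m = q ^+ m *: E 0%N + qint q m.+1 *: alt (tail m * (yprod m * qnonadj m)).
  rewrite /E alt_yprod_last ?m0 // -/(E m.-1) Egeom ?prednK // scalerA -exprS prednK //.
have Esum : \sum_(j < m) E j = qint q m *: E 0%N.
  by rewrite /qint scaler_suml; apply: eq_bigr => -[j lt_j] _ /=; apply: Egeom.
have E_tot : \sum_(j < m) E j + E m = 0.
  transitivity (alt (tail m.+1 * yp m.+1 * yprod m * qnonadj m.+1)); last first.
    have lt_d : (m.-1 < m.+1.-1)%N by rewrite /=; lia.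
    have lt_m' : (0 < m.+1 <= n)%N by [].
    exact: (alt_yp_top q char2 lt_m' (@rdeg_le_yprod 0 m.+1 m) lt_d (@sym_on_tail m.+1)).
  rewrite ypE mulr_sumr !mulr_suml alt_sum [RHS]big_ord_recr /=.
  congr (_ + _); first (apply: eq_bigr => j _); by rewrite /E (mulrAC _ (yprod m)).
have E0 : E 0%N = - alt (tail m * (yprod m * qnonadj m)).
  apply/eqP; rewrite -addr_eq0; move: E_tot; rewrite Esum Elast addrA -scalerDl.
  have -> : qint q m + q ^+ m = qint q m.+1 by rewrite /qint big_ord_recr.
  rewrite -scalerDr => /eqP; rewrite scaler_eq0 (negPf (qint0 m.+1 _)) //.
have -> : alt (tail m.+1 * (yprod m.+1 * qnonadj m.+1)) = \sum_(j < m) E j.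
  rewrite -alt_sum; congr alt; rewrite /yprod big_nat_recr //= -/(yprod m) ypE.
  rewrite !(mulr_sumr, mulr_suml); apply: eq_bigr => j _; ring.
rewrite Esum E0 IHm ?m0 1?ltnW // scalerN -scaleNr scalerA; congr (_ *: _).
have -> : qfact q m = qfact q m.-1 * qint q m.
  by rewrite -{1}(prednK m0) /qfact big_ord_recr /= prednK.
have -> : (-1) ^+ m = - (-1) ^+ m.-1 :> k by rewrite -{1}(prednK m0) exprS mulN1r.
ring.
Qed.

End ElementarySymmetric.

(** * Divided symmetrization as a ratio of alternants *)

Section FractionProducts.
Variable A : idomainType.
Implicit Types (f d g v : A).

Lemma tofrac_prod_div (I : Type) (r : seq I) (P : pred I) (N D : I -> A) :
  \prod_(i <- r | P i) ((N i)%:F / (D i)%:F) =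
  (\prod_(i <- r | P i) N i)%:F / (\prod_(i <- r | P i) D i)%:F :> {fraction A}.
Proof. by rewrite prodf_div !(rmorph_prod (@FracField.tofrac A)). Qed.

Lemma tofrac_sum_div (I : Type) (r : seq I) (P : pred I) (N : I -> A) v :
  \sum_(i <- r | P i) ((N i)%:F / v%:F) = (\sum_(i <- r | P i) N i)%:F / v%:F :> {fraction A}.
Proof. by rewrite -mulr_suml (raddf_sum (@FracField.tofrac A)). Qed.

(** In its use [d] is the product over adjacent pairs, [g] the one over non-adjacent pairs and [v]
    the Vandermonde determinant. *)
Lemma tofrac_sign_cancel (b : nat) f d g v : d != 0 -> v != 0 ->
  f%:F / ((-1) ^+ b * d)%:F * ((g * d)%:F / v%:F) =
  ((-1) ^+ b * (f * g))%:F / v%:F :> {fraction A}.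
Proof.
move=> d0 v0; have s0 : (-1) ^+ b != 0 :> A by rewrite signr_eq0.
rewrite mulf_div -!tofracM; apply/eqP.
rewrite eqr_div ?tofrac_eq0 ?mulf_neq0 // -!tofracM tofrac_eq; apply/eqP.
have sK : (-1) ^+ b * (-1) ^+ b = 1 :> A by rewrite -signr_odd -signr_addb addbb.
transitivity ((-1) ^+ b * (-1) ^+ b * (f * (g * d) * v)); last by ring.
by rewrite sK mul1r.
Qed.

Lemma tofrac_sign_div (b : bool) f v :
  f%:F / ((-1) ^+ b * v)%:F = ((-1) ^+ b * f)%:F / v%:F :> {fraction A}.
Proof. by case: b; rewrite ?mul1r // expr1 !mulN1r !tofracN invrN mulrN mulNr. Qed.
End FractionProducts.

Lemma dl_expand (K : fieldType) (q x y g g1 : K) : x - y != 0 ->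
  (q - 1) * ((x * g - y * g1) / (x - y)) + g1 = dlA q x y * g + dlB q x y * g1.
Proof. by move=> xy; rewrite /dlA /dlB; field. Qed.

(** For [q = 1] it is [m], nonzero in characteristic 0; otherwise use [q^m - 1 = (q - 1) [m]]. *)
Lemma qint_neq0 (k : fieldType) (q : k) (m : nat) : [pchar k] =i pred0 ->
  (forall l : nat, (0 < l)%N -> q ^+ l = 1 -> q = 1) -> (0 < m)%N -> qint q m != 0.
Proof.
move=> char0 hq m0; have [q1|q1] := eqVneq q 1.
  rewrite /qint q1; under eq_bigr do rewrite expr1n.
  by rewrite sumr_const card_ord ((pcharf0P k).1 char0) -lt0n.
apply: contraNneq q1 => qm; apply/eqP/(hq m m0)/eqP.
by rewrite -subr_eq0 subrX1 -/(qint q m) qm mulr0.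
Qed.

Section QDSFormula.
Variables (k : fieldType) (q : k) (n : nat).
Local Notation R := {mpoly k[n]}.
Local Notation F := {fraction R}.
Local Notation xp := (xp k n).
Local Notation yp := (yp k n).
Local Notation qna := (qnonadj q n).
Local Notation qf := (@qfac k q n).
Local Notation x := (fun i : 'I_n => xF k n i).
Local Notation cq := (cF n q).
Local Notation vdm := (alt (tail k n 0)).
Implicit Types (a b : 'I_n) (f g : R).

Definition fperm_rmorph (s : 'S_n) : {rmorphism F -> F} := @fperm k n s.

Lemma cF_morph : exists phi : {rmorphism k -> F}, phi =1 cF n.
Proof. by exists (@FracField.tofrac R \o @mpolyC n k). Qed.

Lemma TopE a b (h : F) : b = a.+1 :> nat ->
  @Top k q n a h = dlA cq (xF k n a) (xF k n b) * h
                 + dlB cq (xF k n a) (xF k n b) * fperm_rmorph (tperm a b) h.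
Proof.
move=> ab; rewrite -dl_expand; last by apply: xF_subr_neq0; rewrite -(inj_eq val_inj) /=; lia.
rewrite /Top /ddiff /sop (adjE ab) -ab.
have -> : fperm (tperm a b) (xF k n a * h) = xF k n b * fperm_rmorph (tperm a b) h.
  by rewrite -{1}[@fperm k n _]/(fperm_rmorph (tperm a b) : F -> F) rmorphM [X in X * _]fperm_xF tpermL.
by [].
Qed.

Lemma xF_qsub_neq0 a b : a != b -> xF k n a - cq * xF k n b != 0.
Proof.
move=> ab; rewrite subr_eq0 !xF_ord /cF -tofracM tofrac_eq; apply/eqP.
move/(congr1 (fun p : R => p@_(U_(a)%MM))); rewrite mul_mpolyC mcoeffZ !mcoeffX eqxx.
case: eqP => [/mnmP/(_ a)|_ /eqP]; last by rewrite mulr0 oner_eq0.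
by rewrite !mnm1E eqxx eq_sym (negPf ab).
Qed.

(** [tail 0] is the staircase monomial, so its alternant is the Vandermonde determinant. *)
Lemma alt_tail0 : vdm = \prod_(p : 'I_n * 'I_n | (p.1 < p.2)%N) (xp p.2 - xp p.1).
Proof.
pose v : 'rV[R]_n := \row_j xp j.
transitivity (\det (Vandermonde n v)).
  rewrite altE; apply: eq_bigr => w _.
  rewrite /tail big_mkord (rmorph_prod (msym w)) /= scaler_sign -mulr_sign; congr (_ * _).
  by apply: eq_bigr => l _; rewrite (rmorphXn (msym w)) /= msym_xp !mxE.
rewrite det_Vandermonde (pair_big_dep xpredT (fun i j : 'I_n => (i < j)%N)) /=.
by apply: eq_bigr => p _; rewrite !mxE.
Qed.

Lemma vdm_neq0 : vdm != 0.
Proof.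
rewrite alt_tail0; apply/prodf_neq0 => -[a b] /= ltab.
rewrite subr_eq0 !xp_ord (inj_eq (@mpolyXU_inj k n)).
by rewrite -(inj_eq val_inj) /=; lia.
Qed.

Lemma prod_qfac_pairs :
  \prod_(p : 'I_n * 'I_n | (p.1 < p.2)%N) qf p.1 p.2 =
  \prod_(0 <= b < n) @qrow k q n b b.
Proof.
rewrite -(pair_big_dep xpredT (fun a b : 'I_n => (a < b)%N) (fun a b => qf a b)) /=.
rewrite (exchange_big_dep xpredT) //= big_mkord; apply: eq_bigr => b _.
rewrite /qrow (big_nat_widen _ _ _ _ _ (ltnW (ltn_ord b))) big_mkord.
by apply: eq_bigl => a.
Qed.

Lemma prod_qrow_diag : (0 < n)%N ->
  \prod_(0 <= b < n) @qrow k q n b b = qna n * \prod_(j < n.-1) qf j j.+1.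
Proof.
move=> n0; have q0 j : @qrow k q n 0 j = 1 by rewrite /qrow big_geq.
rewrite big_ltn // q0 mul1r /qnonadj [X in _ = X * _]big_ltn //= q0 mul1r.
rewrite -(big_mkord xpredT (fun j => qf j j.+1)).
have <- : \prod_(1 <= b < n) qf b.-1 b = \prod_(0 <= j < n.-1) qf j j.+1 by rewrite big_add1.
rewrite -big_split /= !big_nat; apply: eq_bigr => b /andP[b0 _].
by rewrite -qrowS prednK.
Qed.

Lemma qfac_tofrac (a b : nat) : (qf a b)%:F = xF k n b - cq * xF k n a.
Proof. by rewrite /qfac -mul_mpolyC tofracB tofracM. Qed.

Lemma weightE :
  weight x cq = (\prod_(0 <= b < n) @qrow k q n b b)%:F / vdm%:F.
Proof.
rewrite alt_tail0 -prod_qfac_pairs -tofrac_prod_div; apply: eq_bigr => p _.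
by rewrite qfac_tofrac tofracB.
Qed.

(** The denominator is antisymmetric; its sign turns a sum over permutations into an alternant. *)
Lemma fperm_div_vdm (w : 'S_n) g :
  fperm w (g%:F / vdm%:F) = ((-1) ^+ w *: msym w g)%:F / vdm%:F.
Proof.
rewrite (fperm_frac _ _ vdm_neq0) msym_alt !scaler_sign -!mulr_sign.
exact: tofrac_sign_div.
Qed.

Lemma sum_fperm_div_vdm g :
  \sum_(w : 'S_n) fperm w (g%:F / vdm%:F) = (alt g)%:F / vdm%:F.
Proof.
rewrite (eq_bigr _ (fun w _ => fperm_div_vdm w g)).
by rewrite tofrac_sum_div (altE g).
Qed.

Hypothesis char2 : 2%:R != 0 :> k.
Hypothesis qint0 : forall m, (0 < m <= n)%N -> qint q m != 0.

Lemma tail_end : tail k n n = 1.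
Proof. by rewrite /tail big_geq. Qed.

Lemma symmetrizer1 : symmetrizer fperm_rmorph x cq 1 = cF n (qfact q n).
Proof.
rewrite /symmetrizer weightE mul1r [LHS]sum_fperm_div_vdm.
have := alt_qprod q char2 (leqnn n); rewrite tail_end mul1r => ->.
by rewrite -mul_mpolyC tofracM mulfK // tofrac_eq0 vdm_neq0.
Qed.

Lemma qfact_cF : cF n (qfact q n) = qfact cq n.
Proof.
have [phi E] := cF_morph; rewrite -!E /qfact rmorph_prod; apply: eq_bigr => i _.
by rewrite /qint rmorph_sum; apply: eq_bigr => j _; rewrite rmorphXn.
Qed.

Lemma qfact_cF_neq0 : qfact cq n != 0.
Proof.
rewrite -qfact_cF; have [phi <-] := cF_morph; rewrite fmorph_eq0.
by apply/prodf_neq0 => i _; apply: qint0; rewrite /= ltn_ord.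
Qed.

(** [Tsum_symmetrizer] replaces the sum of the [T_w]; the adjacent factors of the weight then cancel
    the denominator, each with a sign since [q x_j - x_(j+1) = - qfac j j.+1]. *)
Lemma qDS_alt f : (0 < n)%N ->
  qDS q f = ((-1) ^+ n.-1 * alt (f * qna n))%:F / vdm%:F.
Proof.
move=> n0; have x_act s (i : 'I_n) : fperm_rmorph s (xF k n i) = xF k n (s i) by apply: fperm_xF.
have q_act s : fperm_rmorph s cq = cq by apply: fperm_cF.
have := @Tsum_symmetrizer n F fperm_rmorph x cq (@Top k q n) (@fpermM k n) (@fperm1 k n) x_act q_act
  (@xF_subr_neq0 k n) xF_qsub_neq0 TopE.
move=> S; have {}S (g : F) := S g (etrans symmetrizer1 qfact_cF) qfact_cF_neq0.
rewrite [LHS](S _) /symmetrizer weightE prod_qrow_diag //.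
have -> : \prod_(j < n.-1) (cq * xF k n j - xF k n j.+1) =
          ((-1) ^+ n.-1 * \prod_(j < n.-1) qf j j.+1)%:F.
  rewrite -[X in (-1) ^+ X]card_ord -prodrN (rmorph_prod (@FracField.tofrac R)).
  by apply: eq_bigr => j _; rewrite /= tofracN qfac_tofrac opprB.
rewrite tofrac_sign_cancel ?vdm_neq0 //; last first.
  apply/prodf_neq0 => j _; rewrite -tofrac_eq0 qfac_tofrac.
  have lj1 : (j.+1 < n)%N by have := ltn_ord j; lia.
  by apply: (@xF_qsub_neq0 (Ordinal lj1) (Ordinal (ltnW lj1))); rewrite -(inj_eq val_inj) /=; lia.
rewrite [LHS]sum_fperm_div_vdm; congr (_%:F / _).
by rewrite -signr_odd !mulr_sign; case: odd => //; exact: raddfN.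
Qed.

End QDSFormula.

(** * Solutions of the recurrence *)

Section LinearRecurrence.
Variables (K : fieldType) (q : K) (P : K -> Prop) (N : nat).
Hypothesis P0 : P 0.
Hypothesis PB : forall x y, P x -> P y -> P (x - y).
Hypothesis Pq : forall x, P x -> P (q * x).
Hypothesis Pdiv : forall m x, (0 < m <= N)%N -> P x -> P (x / qint q m).
Hypothesis qint_neq0 : forall m, (0 < m <= N)%N -> qint q m != 0.

Let PD x y : P x -> P y -> P (x + y).
Proof. by move=> Px Py; rewrite -[y]opprK -[- y]sub0r; apply: PB => //; apply: PB. Qed.

Lemma closed_qint_mul m x : P x -> P (qint q m * x).
Proof.
move=> Px; rewrite /qint mulr_suml; elim: m => [|m IHm]; first by rewrite big_ord0.
rewrite big_ord_recr; apply: PD => //=; elim: (m) => [|l IHl]; first by rewrite mul1r.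
by rewrite exprS -mulrA; apply: Pq.
Qed.

(* The recurrence makes the increments of [g] geometric. *)
Lemma closed_linear_recurrence (g : nat -> K) L : (0 < L <= N)%N ->
  (forall l, (l.+1 < L)%N -> (q + 1) * g l.+1 = q * g l + g l.+2) ->
  P (g 0%N) -> P (g L) -> forall l, (l <= L)%N -> P (g l).
Proof.
move=> rL rec Pg0 PgL; pose d := g 1%N - g 0%N.
have incr l : (l < L)%N -> g l.+1 = g l + q ^+ l * d.
  elim: l => [|l IHl] lt_l; first by rewrite /d; ring.
  have E := rec l lt_l; have -> : g l.+2 = (q + 1) * g l.+1 - q * g l by rewrite E; ring.
  have {}IHl := IHl (ltnW lt_l); rewrite mulrDl mul1r.
  have -> : q ^+ l.+1 * d = q * (g l.+1 - g l) by rewrite IHl exprS; ring.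
  by ring.
have gE l : (l <= L)%N -> g l = g 0%N + qint q l * d.
  elim: l => [|l IHl] lt_l; first by rewrite /qint big_ord0 mul0r addr0.
  by rewrite incr // IHl 1?ltnW // /qint big_ord_recr /= mulrDl addrA.
have Pd : P d.
  have -> : d = (g L - g 0%N) / qint q L.
    by rewrite gE // [g 0%N + _]addrC addrK mulrC mulKf ?qint_neq0.
  by apply: Pdiv => //; apply: PB.
by move=> l le_l; rewrite gE //; apply: PD => //; apply: closed_qint_mul.
Qed.
End LinearRecurrence.

(** * Propagation of a closed property by moving one particle *)

Section RemixedUniqueness.
Variables (K : fieldType) (q : K) (P : K -> Prop) (r : nat) (V : seq nat -> K).
Hypothesis P0 : P 0.
Hypothesis PB : forall x y, P x -> P y -> P (x - y).
Hypothesis Pq : forall x, P x -> P (q * x).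
Hypothesis Pdiv : forall m x, (0 < m <= r.+1)%N -> P x -> P (x / qint q m).
Hypothesis qint_neq0 : forall m, (0 < m <= r.+1)%N -> qint q m != 0.
Hypothesis V_rec : remixed_rec q r V.
Hypothesis V_ones : P (V (nseq r 1%N)).

Lemma wcomp_all1 c : wcomp r c -> (forall i, (i < r)%N -> (nth 0%N c i <= 1)%N) -> c = nseq r 1%N.
Proof.
case/andP=> /eqP sz /eqP; rewrite -sz; elim: c {sz} => //= x c IHc E le1.
have lec : forall i, (i < size c)%N -> (nth 0%N c i <= 1)%N.
  by move=> i lt_i; apply: (le1 i.+1).
have le_sum : (sumn c <= size c)%N.
  elim: c lec {IHc E le1} => //= y c IHc le1.
  have := le1 0%N isT; have := IHc (fun i => le1 i.+1); rewrite /=; lia.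
have := le1 0%N isT; rewrite /= => le_x.
by rewrite -IHc //; [congr (_ :: _); lia|lia].
Qed.

Definition incr_at c i := set_nth 0%N c i (nth 0%N c i).+1.
Definition decr_at c i := set_nth 0%N c i (nth 0%N c i).-1.

Lemma set_nth_id c i : (i < size c)%N -> set_nth 0%N c i (nth 0%N c i) = c.
Proof.
move=> li; apply: (@eq_from_nth _ 0%N); first by rewrite size_set_nth; lia.
by move=> l _; rewrite nth_set_nth /=; case: eqP => [->|].
Qed.

Lemma incr_decr c i : (i < size c)%N -> (0 < nth 0%N c i)%N -> incr_at (decr_at c i) i = c.
Proof.
move=> li ci; rewrite /decr_at /incr_at nth_set_nth /= eqxx set_set_nth eqxx prednK //.
exact: set_nth_id.
Qed.

Lemma size_incr_at c i : (i < size c)%N -> size (incr_at c i) = size c.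
Proof. by move=> li; rewrite size_set_nth; lia. Qed.

Lemma sumn_incr_at c i : (i < size c)%N -> sumn (incr_at c i) = (sumn c).+1.
Proof.
move=> li; rewrite sumn_set_nth li muln1 mul0n addn0.
have : (nth 0%N c i <= sumn c)%N.
  by rewrite sumnE (big_nth 0%N) big_mkord (bigD1 (Ordinal li)) //= leq_addr.
by lia.
Qed.

Lemma wcomp_move c i u : wcomp r c -> (i < r)%N -> (u < r)%N -> (0 < nth 0%N c i)%N ->
  wcomp r (incr_at (decr_at c i) u).
Proof.
case/andP=> /eqP sz /eqP sum_c lt_i lt_u ci; rewrite /wcomp.
have sz' : size (decr_at c i) = r by rewrite size_set_nth sz; lia.
have := sumn_incr_at (c := decr_at c i) (i := i); rewrite incr_decr ?sz // sz' => E.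
by rewrite size_incr_at ?sumn_incr_at ?sz' // eqxx -E ?sum_c /=.
Qed.

(** With one particle taken out, the recurrence relates the neighbouring sites where it may be put
    back. *)
Lemma shiftL_incr c p : (0 < p < size c)%N -> shiftL (incr_at c p) p = incr_at c p.-1.
Proof.
move=> lp; apply: (@eq_from_nth _ 0%N); first by rewrite !size_set_nth; lia.
move=> l _; rewrite /shiftL /incr_at !nth_set_nth /= !nth_set_nth /= !eqxx.
have [np np'] : (p.-1 == p) = false /\ (p == p.-1) = false by lia.
by rewrite np; case: (eqVneq l p) => [->|nlp]; rewrite ?np' //= nth_set_nth /= (negPf nlp).
Qed.

Lemma shiftR_incr c p : (p.+1 < size c)%N -> shiftR (incr_at c p) p = incr_at c p.+1.
Proof.
move=> lp; apply: (@eq_from_nth _ 0%N); first by rewrite !size_set_nth; lia.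
move=> l _; rewrite /shiftR /incr_at !nth_set_nth /= !nth_set_nth /= !eqxx.
have [np np'] : (p.+1 == p) = false /\ (p == p.+1) = false by lia.
by rewrite np; case: (eqVneq l p) => [->|nlp]; rewrite ?np' //= nth_set_nth /= (negPf nlp).
Qed.

Lemma left_end c i : (0 < nth 0%N c i)%N -> exists a, [/\ (a <= i)%N,
  forall j, (a <= j <= i)%N -> (0 < nth 0%N c j)%N & a = 0%N \/ nth 0%N c a.-1 = 0%N].
Proof.
elim: i => [|i IHi] ci.
  by exists 0%N; split; [|by move=> j; rewrite leqn0 => /eqP->|left].
have [/eqP ci0|ci0] := posnP (nth 0%N c i).
  exists i.+1; split=> //; last by right; apply/eqP.
  by move=> j lj; have -> : j = i.+1 by lia.
have [a [le_ai pos a_end]] := IHi ci0; exists a; split=> //; first by lia.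
by move=> j lj; case: (eqVneq j i.+1) => [->//|nj]; apply: pos; lia.
Qed.

Lemma right_end c i : (i < r)%N -> (0 < nth 0%N c i)%N -> exists b, [/\ (i <= b < r)%N,
  forall j, (i <= j <= b)%N -> (0 < nth 0%N c j)%N & b.+1 = r \/ nth 0%N c b.+1 = 0%N].
Proof.
have [m] := ubnP (r - i); elim: m i => // m IHm i lt_m lt_ir ci.
have only_i j : (i <= j <= i)%N -> (0 < nth 0%N c j)%N.
  by move=> lj; have -> : j = i by lia.
have [lt_i1r|ge_i1r] := ltnP i.+1 r; last by exists i; split=> //; [lia|left; lia].
have [/eqP ci1|ci1] := posnP (nth 0%N c i.+1).
  by exists i; split=> //; [lia|right; apply/eqP].
have [|b [lb pos b_end]] := IHm i.+1 _ lt_i1r ci1; first by lia.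
exists b; split=> //; first by lia.
by move=> j lj; case: (eqVneq j i) => [->//|nj]; apply: pos; lia.
Qed.

(** Site [i] stays occupied and [p] becomes so; the number of empty sites is the induction
    measure. *)
Lemma count0_incr_decr c i p : (i < size c)%N -> (p < size c)%N -> (1 < nth 0%N c i)%N ->
  nth 0%N c p = 0%N ->
  (count (pred1 0%N) (incr_at (decr_at c i) p) < count (pred1 0%N) c)%N.
Proof.
move=> li lp ci cp; have np : p != i by apply: contraL ci => /eqP<-; rewrite cp.
have cp' : nth 0%N (decr_at c i) p = 0%N by rewrite nth_set_nth /= (negPf np).
have sz : size (decr_at c i) = size c by rewrite size_set_nth; lia.
have c_pos : (0 < count (pred1 0%N) c)%N.
  by rewrite -has_count; apply/(has_nthP 0%N); exists p; rewrite //= cp.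
rewrite /incr_at count_set_nth_ltn ?sz // cp' /decr_at count_set_nth_ltn //=.
have [-> ->] : ((nth 0%N c i).-1 == 0%N) = false /\ (nth 0%N c i == 0%N) = false by lia.
move: c_pos; move: (count _ _) => N; rewrite /=; lia.
Qed.

(** Used twice: [P] is membership in the image of [k] to show that the values are scalars, and
    vanishing to show uniqueness. *)
Lemma closed_remixed c : wcomp r c -> P (V c).
Proof.
have [m] := ubnP (count (pred1 0%N) c); elim: m c => // m IHm c lt_m wc.
have [/existsP[[i lt_ir] /= ci]|] := boolP [exists i : 'I_r, (1 < nth 0%N c i)%N]; last first.
  rewrite negb_exists => /forallP le1; rewrite (wcomp_all1 wc) // => i lt_i.
  by have := le1 (Ordinal lt_i); rewrite -leqNgt.
have [/eqP sz /eqP sum_c] := andP wc; pose c' := decr_at c i.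
have sz' : size c' = r by rewrite size_set_nth sz; lia.
have c'_i : incr_at c' i = c by apply: incr_decr; [rewrite sz|lia].
have wc' p : (p < r)%N -> wcomp r (incr_at c' p).
  by move=> lt_p; apply: wcomp_move => //; lia.
have [a [le_ai pos_l a_end]] := left_end (ltnW ci).
have [b [le_ib pos_r b_end]] := right_end lt_ir (ltnW ci).
have pos' j : (a <= j <= b)%N -> (0 < nth 0%N c' j)%N.
  move=> lj; rewrite nth_set_nth /=; case: eqP => [_|/eqP nji]; first by lia.
  by have [lt_ji|ge_ji] := leqP j i; [apply: pos_l|apply: pos_r]; lia.
(* Sites are numbered from 1, so that [U 0] and [U r.+1] stand for the omitted terms of the
   recurrence. *)
pose U p := if (0 < p <= r)%N then V (incr_at c' p.-1) else 0.
have P_empty p : (p < r)%N -> nth 0%N c p = 0%N -> P (U p.+1).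
  move=> lt_p cp; rewrite /U /= lt_p; apply: IHm (wc' _ lt_p).
  by have := count0_incr_decr _ _ ci cp; rewrite sz => /(_ lt_ir lt_p); rewrite -/c'; lia.
(* [U a] and [U b.+2] lie just outside the occupied interval: the particle leaves the sites, giving
   0, or fills an empty one, where induction applies. Inside, the site holds at least two particles
   and [V_rec] applies. *)
suff PU l : (l <= (b - a).+2)%N -> P (U (a + l)%N).
  have := PU (i - a).+1; rewrite addnS subnKC // /U /= lt_ir c'_i; apply; lia.
apply: (closed_linear_recurrence P0 PB Pq Pdiv qint_neq0 (g := fun l => U (a + l)%N)).
- by lia.
- move=> {}l lt_l; have lt_p : (a + l < r)%N by lia.
  have nth_p : (1 < nth 0%N (incr_at c' (a + l)) (a + l))%N.
    by rewrite nth_set_nth /= eqxx ltnS; apply: pos'; lia.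
  have := V_rec (wc' _ lt_p) lt_p nth_p; rewrite !addnS /U /= lt_p => ->; congr (_ + _).
    case: posnP => [->|p0]; first by rewrite mulr0.
    by rewrite shiftL_incr ?sz' ?p0 // ltnW.
  by case: ifP => // lt_p1; rewrite shiftR_incr ?sz'.
- rewrite addn0; case: a_end => [->|]; first exact: P0.
  case: a le_ai {pos_l pos'} => [|a] le_ai /= ca; first exact: P0.
  by apply: P_empty => //; lia.
have -> : (a + (b - a).+2 = b.+2)%N by lia.
case: b_end => [Eb|cb]; first by rewrite /U Eb ltnn andbF; exact: P0.
have [lt_b|ge_b] := ltnP b.+1 r; first exact: P_empty.
by rewrite /U (leqNgt b.+2) (ltnS r) ge_b andbF; exact: P0.
Qed.

Lemma wcomp_shiftL c i : wcomp r c -> (0 < i < r)%N -> (2 <= nth 0%N c i)%N ->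
  wcomp r (shiftL c i).
Proof.
move=> wc /andP[i0 lt_i] ci; have [/eqP sz _] := andP wc.
have sz' : size (decr_at c i) = r by rewrite size_set_nth sz; lia.
rewrite -[c](@incr_decr c i) ?sz //; last by lia.
by rewrite shiftL_incr ?sz' ?i0 //; apply: wcomp_move => //; lia.
Qed.

Lemma wcomp_shiftR c i : wcomp r c -> (i.+1 < r)%N -> (2 <= nth 0%N c i)%N ->
  wcomp r (shiftR c i).
Proof.
move=> wc lt_i ci; have [/eqP sz _] := andP wc; have lt_i' := ltnW lt_i.
have sz' : size (decr_at c i) = r by rewrite size_set_nth sz; lia.
rewrite -[c](@incr_decr c i) ?sz //; last by lia.
by rewrite shiftR_incr ?sz' //; apply: wcomp_move => //; lia.
Qed.

End RemixedUniqueness.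

(** * Remixed Eulerian numbers *)

Section RemixedAlternants.
Variables (k : fieldType) (q : k) (r : nat).
Local Notation n := r.+1.
Local Notation R := {mpoly k[n]}.
Local Notation yp := (yp k n).
Local Notation qnonadj := (qnonadj q n).
Hypothesis char2 : 2%:R != 0 :> k.
Hypothesis qint0 : forall m, (0 < m <= n)%N -> qint q m != 0.
Implicit Types (c : seq nat) (e d : nat -> nat).

Definition ymon d : R := \prod_(j < r) yp j.+1 ^+ d j.

Lemma ypolyE c : size c = r -> ypoly k n c = ymon (nth 0%N c).
Proof.
move=> sz; by rewrite /ypoly sz; apply: eq_bigr => i _; congr (_ ^+ _).
Qed.

(** Exhibits the three monomials of the recurrence as multiples of one common factor. *)
Lemma ymon_pair d e (u v : nat) : (u < r)%N -> (v < r)%N ->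
  (forall j, (j < r)%N -> d j = (e j + (j == u) + (j == v))%N) ->
  ymon d = yp u.+1 * yp v.+1 * ymon e.
Proof.
move=> lu lv dE; rewrite /ymon.
rewrite (eq_bigr (fun j : 'I_r => yp j.+1 ^+ e j * yp j.+1 ^+ (j == u :> nat) * yp j.+1 ^+ (j == v :> nat))).
  have single w : (w < r)%N -> \prod_(j < r) yp j.+1 ^+ (j == w :> nat) = yp w.+1.
    move=> lw; rewrite (bigD1 (Ordinal lw)) //= eqxx expr1 big1 ?mulr1 // => j.
    by rewrite -(inj_eq val_inj) /= => /negPf->.
  rewrite !big_split /= (single u lu) (single v lv).
  by rewrite -mulrA [LHS]mulrC.
by move=> j _; rewrite dE // !exprD.
Qed.

Lemma absorbed_ymon i (e : nat -> nat) : (0 < i < n)%N ->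
  absorbed q i n 1 (\sum_(j < r) e j) (ymon e).
Proof.
move=> li; rewrite /ymon -(big_mkord xpredT e) -(big_mkord xpredT (fun j => yp j.+1 ^+ e j)).
have -> : (\sum_(0 <= j < r) e j = \sum_(1 <= j < n) e j.-1)%N by rewrite [RHS]big_add1.
have -> : \prod_(0 <= j < r) yp j.+1 ^+ e j = \prod_(1 <= j < n) yp j ^+ e j.-1.
  by rewrite [RHS]big_add1.
apply: absorbed_prod => // [|j]; first exact: sym_on1.
by rewrite mem_index_iota => /andP[_ /ltnW].
Qed.

Lemma rdeg_le_ymon lo hi e : rdeg_le lo hi (\sum_(j < r) e j) (ymon e).
Proof.
apply: rdeg_le_prod => j _ _.
have := @rdeg_leX k n lo hi 1 (yp j.+1) (e j) (@rdeg_le_yp k n lo hi j.+1).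
by rewrite muln1.
Qed.

Definition qalt (f : R) : R := alt (f * qnonadj n).

(** Expand the vanishing alternant of [yp i.+1 * Z * qfac i i.+1], with [qfac i i.+1 = (yp i.+2 - yp
    i.+1) - q (yp i.+1 - yp i)]. *)
Lemma qalt_ypoly_rec c i : wcomp r c -> (i < r)%N -> (2 <= nth 0%N c i)%N ->
  (q + 1) *: qalt (ypoly k n c) =
    (if (0 < i)%N then q *: qalt (ypoly k n (shiftL c i)) else 0) +
    (if (i.+1 < r)%N then qalt (ypoly k n (shiftR c i)) else 0).
Proof.
case/andP=> /eqP sz /eqP sum_c lt_ir ci.
pose e j := if j == i then (nth 0%N c i).-2 else nth 0%N c j.
have sum_e : (\sum_(j < r) e j)%N.+2 = r.
  rewrite -[RHS]sum_c sumnE (big_nth 0%N) sz big_mkord.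
  rewrite (bigD1 (Ordinal lt_ir)) //= [RHS](bigD1 (Ordinal lt_ir)) //=.
  rewrite [X in (_ = _ + X)%N](eq_bigr (fun j : 'I_r => e j)); last first.
    by move=> j; rewrite -(inj_eq val_inj) /= /e => /negPf->.
  by rewrite {1}/e eqxx; move: (\sum_(_ < _ | _) _)%N => s; lia.
pose Z := ymon e.
have Ec : ypoly k n c = yp i.+1 * yp i.+1 * Z.
  rewrite ypolyE //; apply: ymon_pair => // j _; rewrite /e.
  by case: eqVneq => [->|]; lia.
have EL : (0 < i)%N -> ypoly k n (shiftL c i) = yp i * yp i.+1 * Z.
  move=> i0; rewrite ypolyE; last by rewrite !size_set_nth sz; lia.
  have -> : yp i = yp i.-1.+1 by rewrite prednK.
  apply: ymon_pair => //; first by lia.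
  move=> j _; rewrite /shiftL !nth_set_nth /= !nth_set_nth /= /e.
  case: (eqVneq j i) => [->|nji]; first by have -> : (i == i.-1) = false by [lia]; lia.
  by case: eqVneq => [->|]; lia.
have ER : (i.+1 < r)%N -> ypoly k n (shiftR c i) = yp i.+1 * yp i.+2 * Z.
  move=> i1; rewrite ypolyE; last by rewrite !size_set_nth sz; lia.
  apply: ymon_pair => // j _; rewrite /shiftR !nth_set_nth /= !nth_set_nth /= /e.
  case: (eqVneq j i.+1) => [->|nji]; last by case: (eqVneq j i) => [_|_]; lia.
  by have -> : (i.+1 == i) = false by [lia]; lia.
have li : (0 < i.+1 < n)%N by lia.
have van : alt (1 * yp i.+1 * Z * (@qfac k q n i i.+1 * qnonadj n)) = 0.
  have lt_e : (\sum_(j < r) e j < n.-2)%N by rewrite -ltnS -ltnS; lia.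
  exact: (alt_yp_vanish (@absorbed_ymon i.+1 e li) lt_e).
have key : (q + 1) *: qalt (yp i.+1 * yp i.+1 * Z) =
    q *: qalt (yp i * yp i.+1 * Z) + qalt (yp i.+1 * yp i.+2 * Z).
  apply/eqP; rewrite -subr_eq0 /qalt -!altZ -altD -altB -oppr_eq0 -scaleN1r -altZ.
  apply/eqP; rewrite -[RHS]van; congr alt; rewrite scaleN1r.
  have -> : @qfac k q n i i.+1 = (yp i.+2 - yp i.+1) - q *: (yp i.+1 - yp i).
    by rewrite /qfac !ypS; congr (_ - q *: _); ring.
  rewrite -!mul_mpolyC mpolyCD mpolyC1; ring.
(* The omitted terms vanish: the left one because [yp 0 = 0], the right one by [alt_yp_top], as
   [yp n] is symmetric in all variables. *)
rewrite Ec key; congr (_ + _).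
  by case: posnP => [->|/EL->//]; rewrite yp0 !mul0r /qalt mul0r raddf0 scaler0.
case: ifP => [/ER->//|/negbT]; rewrite -leqNgt => ge_i.
have Ei : i.+2 = n by lia.
rewrite /qalt Ei; have dp : rdeg_le 0 n (1 + \sum_(j < r) e j) (yp i.+1 * Z).
  by apply: rdeg_leM; [apply: rdeg_le_yp|apply: rdeg_le_ymon].
have ln : (0 < n <= n)%N by rewrite /=.
have lt_d : (1 + \sum_(j < r) e j < n.-1)%N.
  by move: (\sum_(j < r) e j)%N sum_e => s /= <-; rewrite add1n.
rewrite -[RHS](alt_yp_top q char2 ln dp lt_d (@sym_on1 k n 0 n)).
by congr alt; ring.
Qed.

Lemma qalt_ones : qalt (ypoly k n (nseq r 1%N)) = ((-1) ^+ r * qfact q r) *: alt (tail k n 0).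
Proof.
have ln : (0 < n <= n)%N by rewrite /=.
rewrite -(alt_yprod char2 qint0 ln) tail_end mul1r /qalt; congr (alt (_ * _)).
rewrite ypolyE ?size_nseq // /ymon /yprod big_add1 big_mkord.
by apply: eq_bigr => j _; rewrite nth_nseq ltn_ord.
Qed.

Definition qDS_of_alt (g : R) : {fraction R} := ((-1) ^+ r * g)%:F / (alt (tail k n 0))%:F.

Lemma qDS_of_altD g h : qDS_of_alt (g + h) = qDS_of_alt g + qDS_of_alt h.
Proof. by rewrite /qDS_of_alt mulrDr tofracD mulrDl. Qed.

Lemma qDS_of_altZ (a : k) g : qDS_of_alt (a *: g) = cF n a * qDS_of_alt g.
Proof. by rewrite /qDS_of_alt -scalerAr -mul_mpolyC tofracM mulrA. Qed.

Lemma qDS_ypoly c : qDS q (ypoly k n c) = qDS_of_alt (qalt (ypoly k n c)).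
Proof. exact: qDS_alt. Qed.

Lemma qDS_rec : remixed_rec (cF n q) r (fun c => qDS q (ypoly k n c)).
Proof.
have z0 : qDS_of_alt 0 = 0 by rewrite /qDS_of_alt mulr0 tofrac0 mul0r.
have cF1 : cF n (q + 1) = cF n q + 1.
  by have [phi E] := @cF_morph k n; rewrite -!E rmorphD rmorph1.
move=> c i wc lt_ir ci; rewrite !qDS_ypoly -cF1 -qDS_of_altZ (qalt_ypoly_rec wc lt_ir ci).
by rewrite qDS_of_altD; congr (_ + _); case: ifP => // _; rewrite qDS_of_altZ.
Qed.

Lemma qDS_ones : qDS q (ypoly k n (nseq r 1%N)) = cF n (qfact q r).
Proof.
rewrite qDS_ypoly qalt_ones; have sK : (-1) ^+ r * (-1) ^+ r = 1 :> k.
  by rewrite -signr_odd -signr_addb addbb.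
have E : (-1) ^+ r = ((-1) ^+ r : k)%:MP :> R by rewrite rmorphXn rmorphN1.
rewrite /qDS_of_alt E mul_mpolyC scalerA mulrA sK mul1r -mul_mpolyC tofracM.
by rewrite mulfK // tofrac_eq0 vdm_neq0.
Qed.

(** A priori a rational function: the recurrence and the all-ones value keep it in the image of [k],
    a subfield containing [q]. *)
Lemma qDS_scalar c : wcomp r c -> exists a, qDS q (ypoly k n c) = cF n a.
Proof.
have [phi E] := @cF_morph k n; have qintE m : qint (cF n q) m = phi (qint q m).
  by rewrite /qint rmorph_sum; apply: eq_bigr => j _; rewrite rmorphXn -E.
apply: (closed_remixed (P := fun x => exists a, x = cF n a) _ _ _ _ _ qDS_rec).
- by exists 0; rewrite -E rmorph0.
- by move=> _ _ [a ->] [b ->]; exists (a - b); rewrite -!E rmorphB.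
- by move=> _ [a ->]; exists (q * a); rewrite -!E rmorphM.
- by move=> m _ _ [a ->]; exists (a / qint q m); rewrite qintE -!E rmorphM fmorphV.
- by move=> m lm; rewrite qintE fmorph_eq0 qint0.
by exists (qfact q r); apply: qDS_ones.
Qed.

End RemixedAlternants.

(** The recurrence is linear, so [A - B] satisfies it and starts from 0. *)
Lemma remixed_unique (k : fieldType) (q : k) (r : nat) (A B : seq nat -> k) :
  (forall m, (0 < m <= r.+1)%N -> qint q m != 0) ->
  remixed_rec q r A -> remixed_rec q r B -> A (nseq r 1%N) = B (nseq r 1%N) ->
  forall c, wcomp r c -> A c = B c.
Proof.
move=> qint0 recA recB AB c wc; apply/eqP; rewrite -subr_eq0; apply/eqP.
apply: (closed_remixed (q := q) (P := fun x => x = 0) (V := fun c => A c - B c)) wc => //.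
- by move=> x y -> ->; rewrite subr0.
- by move=> x ->; rewrite mulr0.
- by move=> m x _ ->; rewrite mul0r.
- move=> d i wd lt_i di; rewrite mulrBr (recA _ _ wd lt_i di) (recB _ _ wd lt_i di).
  by do 2 case: ifP => _; ring.
by rewrite AB subrr.
Qed.

Theorem theorem1p2 (k : fieldType) (hchar : [pchar k] =i pred0) (q : k)
  (hq : forall m : nat, (0 < m)%N -> q ^+ m = 1 -> q = 1)
  (r : nat) (hr : (0 < r)%N) :
  exists A : seq nat -> k,
    [/\ (forall c, wcomp r c -> @qDS k q r.+1 (@ypoly k r.+1 c) = @cF k r.+1 (A c)),
        A (nseq r 1%N) = qfact q r,
        remixed_rec q r A &
        forall B : seq nat -> k,
          B (nseq r 1%N) = qfact q r -> remixed_rec q r B ->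
          forall c, wcomp r c -> B c = A c].
Proof.
have char2 : 2%:R != 0 :> k by rewrite ((pcharf0P k).1 hchar).
have qint0 m : (0 < m <= r.+1)%N -> qint q m != 0.
  by case/andP=> m0 _; apply: qint_neq0.
have [phi phiE] := @cF_morph k r.+1.
(* [A] is unspecified outside [wcomp], hence the appeals below to [wcomp_shiftL] and
   [wcomp_shiftR]. *)
have [A AE] : exists A : seq nat -> k,
    forall c, wcomp r c -> qDS q (ypoly k r.+1 c) = cF r.+1 (A c).
  exists (fun c => epsilon (inhabits 0) (fun a => qDS q (ypoly k r.+1 c) = cF r.+1 a)) => c wc.
  exact: (epsilon_spec (inhabits 0) (fun a => qDS q (ypoly k r.+1 c) = cF r.+1 a)
    (qDS_scalar char2 qint0 wc)).
have wc1 : wcomp r (nseq r 1%N) by rewrite /wcomp size_nseq sumn_nseq mul1n !eqxx.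
have A1 : A (nseq r 1%N) = qfact q r.
  apply: (fmorph_inj phi); rewrite !phiE -AE //; exact: qDS_ones.
have recA : remixed_rec q r A.
  move=> c i wc lt_ir ci; have := qDS_rec char2 qint0 wc lt_ir ci.
  rewrite (AE c wc) => E; apply: (fmorph_inj phi).
  rewrite [RHS]rmorphD [LHS]rmorphM [phi (q + 1)]rmorphD rmorph1 [phi q]phiE [phi (A c)]phiE E.
  congr (_ + _); case: ifP => [lt_i|_]; rewrite ?rmorph0 //.
    by rewrite rmorphM !phiE AE // wcomp_shiftL ?lt_i.
  by rewrite phiE AE // wcomp_shiftR.
exists A; split=> // B B1 recB c wc.
by apply: (remixed_unique qint0 recB recA) wc; rewrite B1 A1.
Qed.
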